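(* For any directed graph $E$ and any field $K$, the following are equivalent: (1) each graded ideal of $L_K(E)$ is an annihilator ideal; (2) (a) each cycle in $E$ is either without exits or extreme; (b) each infinite emitter lies on a cycle; and (c) for each infinite path $\alpha$, there are only finitely many edges $e$ with $\mathbf{s}(e)\in\alpha^0$ and $\mathbf{r}(e)\notin R(\alpha^0)$.
   Context: $L_K(E)$ is the Leavitt path algebra of $E$ over $K$ (generated by vertices, edges $e$ and $e^*$ with: orthogonal idempotent vertices, $\mathbf{s}(e)e=e\mathbf{r}(e)=e$, $\mathbf{r}(e)e^*=e^*\mathbf{s}(e)=e^*$, $e^*f=\delta_{e,f}\mathbf{r}(e)$, and $v=\sum_{\mathbf{s}(e)=v}ee^*$ for each vertex emitting a nonzero finite number of edges), $\mathbb{Z}$-graded with degree $n$ spanned by $pq^*$, $|p|-|q|=n$; an ideal $I$ is graded if $I=\bigoplus_n(I\cap L_K(E)_n)$. $\operatorname{ann}(I)=\{r\mid rI=Ir=0\}$; $I$ is an annihilator ideal if $\operatorname{ann}(\operatorname{ann}(I))=I$. A cycle is a closed path of positive length whose edges have distinct sources; an exit is an edge with source on the cycle not belonging to it. A cycle $c$ is extreme if it has exits and for every path $p$ with $\mathbf{s}(p)\in c^0$ there is a path $q$ with $\mathbf{s}(q)=\mathbf{r}(p)$, $\mathbf{r}(q)\in c^0$. An infinite emitter emits infinitely many edges. An infinite path is a sequence of edges $e_1e_2\dots$ with $\mathbf{r}(e_n)=\mathbf{s}(e_{n+1})$; $\alpha^0$ is its vertex set. $u\ge v$ means there is a path (possibly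 of length 0) from $u$ to $v$; $R(V)=\{u\mid u\ge v$ for some $v\in V\}$. *)

(* Defs.v *)
From HB Require Import structures.
From mathcomp Require Import all_boot all_order all_algebra.
From Stdlib Require List.
From Stdlib Require Import ClassicalEpsilon.
Notation In := List.In.
Notation NoDup := List.NoDup.
Set Implicit Arguments.
Unset Strict Implicit.
Unset Printing Implicit Defensive.
Import GRing.Theory.
Local Open Scope ring_scope.

Record graph := Graph {
  vert : Type;
  edge : Type;
  src  : edge -> vert;
  rng  : edge -> vert
}.

Section Graph.
Variable G : graph.

Fixpoint is_path (p : list (edge G)) (u v : vert G) : Prop :=
  match p with
  | nil => u = v
  | e :: p' => src e = u /\ is_path p' (rng e) v
  end.

Definition reach (u v : vert G) : Prop := exists p, is_path p u v.

Definition R_of (V : vert G -> Prop) (u : vert G) : Prop :=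
  exists v, V v /\ reach u v.

Definition is_cycle (c : list (edge G)) : Prop :=
  exists e0 c', c = e0 :: c' /\ is_path c (src e0) (src e0) /\ NoDup (map (@src G) c).

Definition on_cycle (c : list (edge G)) (v : vert G) : Prop := In v (map (@src G) c).

Definition is_exit (c : list (edge G)) (f : edge G) : Prop :=
  on_cycle c (src f) /\ ~ In f c.

Definition has_exit (c : list (edge G)) : Prop := exists f, is_exit c f.

Definition extreme (c : list (edge G)) : Prop :=
  has_exit c /\
  forall (p : list (edge G)) (u v : vert G), on_cycle c u -> is_path p u v ->
    exists (q : list (edge G)) (w : vert G), is_path q v w /\ on_cycle c w.

Definition infinite_emitter (v : vert G) : Prop :=
  ~ exists l : list (edge G), forall e, src e = v -> In e l.

Definition is_infinite_path (a : nat -> edge G) : Prop :=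
  forall n, rng (a n) = src (a n.+1).

Definition inf_path_verts (a : nat -> edge G) (v : vert G) : Prop :=
  exists n, src (a n) = v \/ rng (a n) = v.

Definition condition2 : Prop :=
  (forall c, is_cycle c -> ~ has_exit c \/ extreme c) /\
  (forall v, infinite_emitter v -> exists c, is_cycle c /\ on_cycle c v) /\
  (forall a, is_infinite_path a ->
     exists l : list (edge G), forall e,
       inf_path_verts a (src e) -> ~ R_of (inf_path_verts a) (rng e) -> In e l).

(* The Leavitt path algebra L_K(G), as the free (non-unital) K-algebra on *)
(* the letters v, e, e^* modulo the ideal generated by the relations.     *)
Inductive letter := LV of vert G | LE of edge G | LG of edge G.
Definition word := seq letter.

Definition deg_letter (l : letter) : int :=
  match l with LV _ => 0 | LE _ => 1 | LG _ => -1 end.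
Definition deg (w : word) : int := foldr (fun l n => deg_letter l + n) 0 w.

Variable K : fieldType.

(* coefficient functions on words; elements of the free algebra are those
   with finite support vanishing on the empty word *)
Definition F0 := word -> K.

Definition fsupp (x : F0) : Prop :=
  x [::] = 0 /\ exists s : list word, forall w, x w <> 0 -> In w s.

Definition zeroF : F0 := fun _ => 0.
Definition addF (x y : F0) : F0 := fun w => x w + y w.
Definition oppF (x : F0) : F0 := fun w => - x w.
Definition subF (x y : F0) : F0 := addF x (oppF y).
Definition scaleF (k : K) (x : F0) : F0 := fun w => k * x w.
Definition mulF (x y : F0) : F0 :=
  fun w => \sum_(1 <= i < size w) x (take i w) * y (drop i w).
Definition sumF (l : list F0) : F0 := foldr addF zeroF l.

Definition mon (w : word) : F0 :=
  fun u => if excluded_middle_informative (u = w) then 1 else 0.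

Inductive lpa_rel : F0 -> Prop :=
  | rel_vv_neq v w : v <> w -> lpa_rel (mon [:: LV v; LV w])
  | rel_vv v : lpa_rel (subF (mon [:: LV v; LV v]) (mon [:: LV v]))
  | rel_se e : lpa_rel (subF (mon [:: LV (src e); LE e]) (mon [:: LE e]))
  | rel_er e : lpa_rel (subF (mon [:: LE e; LV (rng e)]) (mon [:: LE e]))
  | rel_rg e : lpa_rel (subF (mon [:: LV (rng e); LG e]) (mon [:: LG e]))
  | rel_gs e : lpa_rel (subF (mon [:: LG e; LV (src e)]) (mon [:: LG e]))
  | rel_ck1_neq e f : e <> f -> lpa_rel (mon [:: LG e; LE f])
  | rel_ck1 e : lpa_rel (subF (mon [:: LG e; LE e]) (mon [:: LV (rng e)]))
  | rel_ck2 v (l : list (edge G)) :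
      l <> nil -> NoDup l -> (forall e, In e l <-> src e = v) ->
      lpa_rel (subF (mon [:: LV v]) (sumF (map (fun e => mon [:: LE e; LG e]) l))).

Definition free_ideal (J : F0 -> Prop) : Prop :=
  (forall x, J x -> fsupp x) /\ J zeroF /\
  (forall x y, J x -> J y -> J (addF x y)) /\
  (forall k x, J x -> J (scaleF k x)) /\
  (forall a x, fsupp a -> J x -> J (mulF a x) /\ J (mulF x a)).

(* the ideal generated by the relations; x represents 0 in L_K(G) iff Rel x *)
Definition Rel (x : F0) : Prop :=
  forall J, free_ideal J -> (forall g, lpa_rel g -> J g) -> J x.

Definition Leq (x y : F0) : Prop := Rel (subF x y).

(* Ideals of L_K(G), represented by their (saturated) preimage in the free
   algebra: I x means "x is a representative of an element of the ideal". *)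
Definition L_ideal (I : F0 -> Prop) : Prop :=
  (forall x, I x -> fsupp x) /\
  (forall x y, I x -> fsupp y -> Leq x y -> I y) /\
  I zeroF /\
  (forall x y, I x -> I y -> I (addF x y)) /\
  (forall k x, I x -> I (scaleF k x)) /\
  (forall a x, fsupp a -> I x -> I (mulF a x) /\ I (mulF x a)).

(* homogeneous representative of degree n (its class lies in L_K(G)_n) *)
Definition homog (n : int) (x : F0) : Prop :=
  fsupp x /\ forall w, x w <> 0 -> deg w = n.

Definition graded (I : F0 -> Prop) : Prop :=
  forall x, I x -> exists s : list (int * F0),
    (forall p, In p s -> I p.2 /\ homog p.1 p.2) /\ Leq x (sumF (map snd s)).

Definition ann (I : F0 -> Prop) : F0 -> Prop :=
  fun r => fsupp r /\ forall x, I x -> Rel (mulF r x) /\ Rel (mulF x r).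

Definition annihilator_ideal (I : F0 -> Prop) : Prop :=
  forall x, ann (ann I) x <-> I x.

Definition condition1 : Prop :=
  forall I, L_ideal I -> graded I -> annihilator_ideal I.

End Graph.

(* Main.v *)
(** Call a set [H] of vertices hereditary if it is closed under edges, and
saturated if it contains each vertex that emits a positive finite number of edges,
all of them into [H]. Both conditions are equivalent to a third one, [escaping]:
if [H] is hereditary and saturated, then every vertex outside [H] has a descendant
that does not reach [H].

The passage between [escaping] and condition (2) is pure graph theory. If all
descendants of a vertex outside [H] reach [H], one builds an infinite path that
stays outside [H] and infinitely often visits a vertex with an edge into [H]; by
(c) such a vertex repeats, and it lies on a cycle contradicting (a). Conversely,
(2) follows by applying [escaping] to the complements of [R(Y)], for [Y] a cycle, an
infinite emitter, or an infinite path.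

The algebra rests on two facts, valid modulo a graded ideal [I] provided that every
infinite emitter outside [I] emits infinitely many edges to vertices outside [I].
A homogeneous [x] outside [I] generates, modulo [I], some vertex outside [I]: one
multiplies on the right by edges until no ghost edge is left, then on the left by the
adjoint of a path. And if [a v b = u] is a nonzero vertex, then [u] and [v] have a
common descendant. So if [v] does not annihilate a homogeneous [r], then [v] has a
descendant in common with some vertex of the ideal generated by [r].

If (1) holds and all descendants of [v] reach [H], then [v] annihilates the
annihilator of the ideal generated by [H], so it belongs to that ideal; the
representation on the boundary paths avoiding [H] shows that [v] is in [H].
If (2) holds and [ann (ann I)] is larger than [I], it contains a vertex outside [I],
hence by [escaping] a vertex [d] that does not reach [I]; but then [d] annihilates
[I], so [d = d * d = 0]. *)
From HB Require Import structures.
From mathcomp Require Import all_boot all_algebra generic_quotient boolp zify.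
Require Import Defs.
Set Implicit Arguments.
Unset Strict Implicit.
Unset Printing Implicit Defensive.
Import GRing.Theory.
Local Open Scope ring_scope.

(** * Classical decidable equality on graphs and letters *)

HB.instance Definition _ (G : graph) := gen_eqMixin (vert G).
HB.instance Definition _ (G : graph) := gen_eqMixin (edge G).
HB.instance Definition _ (G : graph) := gen_eqMixin (letter G).
HB.instance Definition _ (G : graph) := gen_choiceMixin (letter G).

Lemma In_mem (T : eqType) (x : T) (s : seq T) : In x s <-> x \in s.
Proof.
elim: s => [|y s IH] //=; rewrite in_cons IH; split.
  by case=> [->|->]; rewrite ?eqxx ?orbT.
by case/orP=> [/eqP ->|]; [left|right].
Qed.

Lemma NoDup_uniq (T : eqType) (s : seq T) : NoDup s <-> uniq s.
Proof.
elim: s => [|x s IH] /=; first by split=> // _; constructor.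
split=> [H|/andP[/negP xs us]].
  inversion H; subst; apply/andP; split; last exact/IH.
  by apply/negP => /In_mem.
by constructor; [move/In_mem | exact/IH].
Qed.

(** * The free algebra as a ring of formal series *)

Section FormalSeries.
Variables (G : graph) (K : fieldType).
Implicit Types (x y z : F0 G K) (w : word G) (k : K).

HB.instance Definition _ := gen_eqMixin (F0 G K).
HB.instance Definition _ := gen_choiceMixin (F0 G K).

Let addFA : associative (@addF G K).
Proof. by move=> x y z; apply: funext => w; rewrite /addF addrA. Qed.
Let addFC : commutative (@addF G K).
Proof. by move=> x y; apply: funext => w; rewrite /addF addrC. Qed.
Let add0F : left_id (@zeroF G K) (@addF G K).
Proof. by move=> x; apply: funext => w; rewrite /addF add0r. Qed.
Let addNF : left_inverse (@zeroF G K) (@oppF G K) (@addF G K).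
Proof. by move=> x; apply: funext => w; rewrite /addF addNr. Qed.

HB.instance Definition _ :=
  GRing.isZmodule.Build (F0 G K) addFA addFC add0F addNF.

Let scaleFA k l x : scaleF k (scaleF l x) = scaleF (k * l) x.
Proof. by apply: funext => w; rewrite /scaleF mulrA. Qed.
Let scale1F : left_id 1 (@scaleF G K).
Proof. by move=> x; apply: funext => w; rewrite /scaleF mul1r. Qed.
Let scaleFDr : right_distributive (@scaleF G K) +%R.
Proof. by move=> k x y; apply: funext => w; rewrite /scaleF /= mulrDr. Qed.
Let scaleFDl x : {morph (@scaleF G K)^~ x : k l / k + l}.
Proof. by move=> k l; apply: funext => w; rewrite /scaleF /= mulrDl. Qed.

HB.instance Definition _ :=
  GRing.Zmodule_isLmodule.Build K (F0 G K) scaleFA scale1F scaleFDr scaleFDl.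

Lemma addFE x y w : (x + y) w = x w + y w. Proof. by []. Qed.
Lemma oppFE x w : (- x) w = - x w. Proof. by []. Qed.
Lemma subFE x y : subF x y = x - y. Proof. by []. Qed.
Lemma scaleFE k x w : (k *: x) w = k * x w. Proof. by []. Qed.
Lemma sumFE (l : list (F0 G K)) : sumF l = \sum_(x <- l) x.
Proof. by elim: l => [|x l IH]; rewrite ?big_nil ?big_cons //= IH. Qed.

Lemma sum_coef (I : Type) (r : seq I) (P : pred I) (f : I -> F0 G K) w :
  (\sum_(i <- r | P i) f i) w = \sum_(i <- r | P i) f i w.
Proof. by elim/big_ind2: _ => // x a y b <- <-. Qed.

(* Unlike [mulF], the product [conv] also counts the two trivial splittings of
   a word; it is unital, and it is computed by the Leibniz-type rule for the
   left derivative [x |-> (w |-> x (l :: w))]. *)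
Fixpoint conv x y w : K :=
  if w is l :: w' then x [::] * y w + conv (fun u => x (l :: u)) y w'
  else x [::] * y [::].

Lemma conv_sum x y w :
  conv x y w = \sum_(i < (size w).+1) x (take i w) * y (drop i w).
Proof.
elim: w x => [|l w IH] x /=; first by rewrite big_ord_recl big_ord0 addr0.
by rewrite big_ord_recl /= IH.
Qed.

Let convDl : left_distributive conv +%R.
Proof.
move=> x y z; apply: funext => w; rewrite addFE.
elim: w x y => [|l w IH] x y /=; first by rewrite mulrDl.
by rewrite addFE mulrDl addrACA -IH.
Qed.
Let convDr : right_distributive conv +%R.
Proof.
move=> x y z; apply: funext => w; rewrite addFE.
elim: w x => [|l w IH] x /=; first by rewrite mulrDr.
by rewrite addFE mulrDr IH addrACA.
Qed.
Let convZl k x y : k *: (conv x y : F0 G K) = conv (k *: x) y.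
Proof.
apply: funext => w; rewrite scaleFE.
elim: w x => [|l w IH] x /=; first by rewrite mulrA.
by rewrite mulrDr mulrA IH.
Qed.
Let convZr k x y : k *: (conv x y : F0 G K) = conv x (k *: y).
Proof.
apply: funext => w; rewrite scaleFE.
elim: w x => [|l w IH] x /=; first by rewrite mulrCA.
by rewrite mulrDr mulrCA IH.
Qed.

Let convA : associative conv.
Proof.
move=> x y z; apply: funext => w.
elim: w x y z => [|l w IH] x y z /=; first by rewrite mulrA.
rewrite IH mulrDr mulrA -addrA; congr (_ + _).
(* Leibniz rule: the derivative of [conv x y] along [l] is a sum of two series, to which left
   distributivity applies. *)
have -> : (fun u => x [::] * y (l :: u) + conv (fun v => x (l :: v)) y u)
  = x [::] *: ((fun u => y (l :: u)) : F0 G K)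
    + (conv (fun v => x (l :: v)) y : F0 G K) by [].
by rewrite convDl -convZl.
Qed.

Lemma monE u w : mon K u w = (w == u)%:R.
Proof.
rewrite /mon; case: ClassicalEpsilon.excluded_middle_informative => /= [->|].
  by rewrite eqxx.
by move/eqP/negPf ->.
Qed.

Let conv0x (y : F0 G K) w : conv (fun=> 0) y w = 0.
Proof. by elim: w => [|l w IH] /=; rewrite mul0r ?add0r. Qed.

Let conv1x : left_id (mon K [::]) conv.
Proof.
move=> x; apply: funext => -[|l w] /=; rewrite !monE eqxx mul1r //.
have -> : (fun u => mon K [::] (l :: u)) = fun=> 0.
  by apply: funext => u; rewrite monE.
by rewrite conv0x addr0.
Qed.
Let convx1 : right_id (mon K [::]) conv.
Proof.
move=> x; apply: funext => w.
elim: w x => [|l w IH] x /=; rewrite !monE ?mulr1 //.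
by rewrite IH mulr0 add0r.
Qed.

Let one_neq0 : mon K [::] != 0 :> F0 G K.
Proof.
apply/eqP => /(congr1 (fun x : F0 G K => x [::])).
by rewrite monE => /eqP; rewrite (negPf (oner_neq0 _)).
Qed.

HB.instance Definition _ := GRing.Zmodule_isNzRing.Build (F0 G K)
  convA conv1x convx1 convDl convDr one_neq0.
HB.instance Definition _ :=
  GRing.LSemiModule_isLSemiAlgebra.Build K (F0 G K) convZl.
HB.instance Definition _ :=
  GRing.LSemiAlgebra_isSemiAlgebra.Build K (F0 G K) convZr.

(** The two trivial splittings of a word, which only [conv] counts, contribute 0 when both constant
    coefficients vanish. *)
Lemma mulFE x y : x [::] = 0 -> y [::] = 0 -> mulF x y = x * y.
Proof.
move=> x0 y0; apply: funext => w; rewrite /GRing.mul /= conv_sum /mulF.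
case: w => [|l w].
  by rewrite big_geq // big_ord_recl big_ord0 /= x0 mul0r addr0.
rewrite big_ord_recl big_ord_recr /= x0 mul0r add0r drop_size y0 mulr0 addr0.
by rewrite big_add1 big_mkord.
Qed.

Lemma mon1 : mon K [::] = 1 :> F0 G K. Proof. by []. Qed.

Lemma mul_mon u w : mon K u * mon K w = mon K (u ++ w).
Proof.
elim: u => [|l u IH]; first by rewrite mon1 mul1r.
apply: funext => -[|l' v]; first by rewrite /GRing.mul /= !monE mul0r.
rewrite /GRing.mul /= !monE mul0r add0r eqseq_cons.
have [->|ne] := eqVneq l' l.
  have -> : (fun v => mon K (l :: u) (l :: v)) = mon K u.
    by apply: funext => t; rewrite !monE eqseq_cons eqxx.
  by rewrite -[conv _ _ v]/((mon K u * mon K w) v) IH monE.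
have -> : (fun v => mon K (l :: u) (l' :: v)) = fun=> 0.
  by apply: funext => t; rewrite !monE eqseq_cons (negPf ne).
exact: conv0x.
Qed.

End FormalSeries.

(** * Quotients by two-sided ideals *)

(** Properness is included so that the quotient is a nonzero ring. Opposites and scalars act through
    multiplication by elements of [A]. *)
Record ideal (K : fieldType) (A : algType K) := Ideal {
  ideal_mem :> A -> Prop;
  ideal0 : ideal_mem 0;
  idealD : forall x y, ideal_mem x -> ideal_mem y -> ideal_mem (x + y);
  idealMl : forall a x, ideal_mem x -> ideal_mem (a * x);
  idealMr : forall a x, ideal_mem x -> ideal_mem (x * a);
  ideal1 : ~ ideal_mem 1
}.

Section IdealQuotient.
Local Open Scope quotient_scope.
Variables (K : fieldType) (A : algType K) (I : ideal A).

Lemma idealN x : I x -> I (- x).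
Proof. by rewrite -mulN1r; apply: idealMl. Qed.

Lemma idealZ k x : I x -> I (k *: x).
Proof. by rewrite -[k *: x]mul1r -scalerAr scalerAl; apply: idealMl. Qed.

Definition ideal_eqv (x y : A) : bool := `[< I (x - y) >].

Let eqv_refl : reflexive ideal_eqv.
Proof. by move=> x; apply/asboolP; rewrite subrr; apply: ideal0. Qed.
Let eqv_sym : symmetric ideal_eqv.
Proof.
suff H x y : ideal_eqv x y -> ideal_eqv y x by move=> x y; apply/idP/idP; apply: H.
by move/asboolP/idealN; rewrite opprB => H; apply/asboolP.
Qed.
Let eqv_trans : transitive ideal_eqv.
Proof.
move=> y x z /asboolP xy /asboolP yz; apply/asboolP.
by rewrite -(subrKA y); apply: idealD.
Qed.

Definition ideal_equiv := EquivRel ideal_eqv eqv_refl eqv_sym eqv_trans.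
Definition quot := {eq_quot ideal_equiv}.
HB.instance Definition _ := Choice.on quot.
Definition cls (x : A) : quot := \pi_({eq_quot ideal_equiv}) x.
Let rep (q : quot) : A := repr (q : {eq_quot ideal_equiv}).

Let repK : cancel rep cls.
Proof. by move=> q; rewrite /cls /rep reprK. Qed.

Lemma clsP x y : cls x = cls y <-> I (x - y).
Proof.
split=> [/eqP|Ixy]; first by rewrite /cls /= eqmodE /= => /asboolP.
by apply/eqP; rewrite /cls eqmodE; apply/asboolP.
Qed.

Let rep_cls x : I (rep (cls x) - x).
Proof. by apply/clsP; rewrite repK. Qed.

Lemma cls_surj (q : quot) : exists x, q = cls x.
Proof. by exists (rep q); rewrite repK. Qed.

Definition qadd (p q : quot) := cls (rep p + rep q).
Definition qopp (p : quot) := cls (- rep p).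
Definition qmul (p q : quot) := cls (rep p * rep q).
Definition qscale k (p : quot) := cls (k *: rep p).

Let clsD x y : cls (x + y) = qadd (cls x) (cls y).
Proof.
apply/esym/clsP; rewrite opprD addrACA.
by apply: idealD; apply: rep_cls.
Qed.
Let clsN x : cls (- x) = qopp (cls x).
Proof. by apply/esym/clsP; rewrite -opprD; apply/idealN/rep_cls. Qed.
Let clsZ k x : cls (k *: x) = qscale k (cls x).
Proof. by apply/esym/clsP; rewrite -scalerBr; apply/idealZ/rep_cls. Qed.
Let clsM x y : cls (x * y) = qmul (cls x) (cls y).
Proof.
apply/esym/clsP.
have -> : rep (cls x) * rep (cls y) - x * y =
  rep (cls x) * (rep (cls y) - y) + (rep (cls x) - x) * y.
  by rewrite mulrBr mulrBl addrA subrK.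
by apply: idealD; [apply/idealMl/rep_cls | apply/idealMr/rep_cls].
Qed.

Let qaddA : associative qadd.
Proof.
by move=> p q r; rewrite -[p]repK -[q]repK -[r]repK -!clsD addrA.
Qed.
Let qaddC : commutative qadd.
Proof. by move=> p q; rewrite -[p]repK -[q]repK -!clsD addrC. Qed.
Let qadd0 : left_id (cls 0) qadd.
Proof. by move=> p; rewrite -[p]repK -!clsD add0r. Qed.
Let qaddN : left_inverse (cls 0) qopp qadd.
Proof. by move=> p; rewrite -[p]repK -clsN -!clsD addNr. Qed.
HB.instance Definition _ := GRing.isZmodule.Build quot qaddA qaddC qadd0 qaddN.

Let clsA x y : cls (x + y) = cls x + cls y. Proof. exact: clsD. Qed.

Let qmulA : associative qmul.
Proof.
by move=> p q r; rewrite -[p]repK -[q]repK -[r]repK -!clsM mulrA.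
Qed.
Let qmul1 : left_id (cls 1) qmul.
Proof. by move=> p; rewrite -[p]repK -!clsM mul1r. Qed.
Let qmulr1 : right_id (cls 1) qmul.
Proof. by move=> p; rewrite -[p]repK -!clsM mulr1. Qed.
Let qmulDl : left_distributive qmul +%R.
Proof.
by move=> p q r; rewrite -[p]repK -[q]repK -[r]repK -clsA -!clsM -clsA mulrDl.
Qed.
Let qmulDr : right_distributive qmul +%R.
Proof.
by move=> p q r; rewrite -[p]repK -[q]repK -[r]repK -clsA -!clsM -clsA mulrDr.
Qed.
Let q1_neq0 : cls 1 != 0.
Proof. by apply/eqP => /clsP; rewrite subr0; apply: ideal1. Qed.
HB.instance Definition _ := GRing.Zmodule_isNzRing.Build quot
  qmulA qmul1 qmulr1 qmulDl qmulDr q1_neq0.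

Let qscaleA k l p : qscale k (qscale l p) = qscale (k * l) p.
Proof. by rewrite -[p]repK -!clsZ scalerA. Qed.
Let qscale1 : left_id 1 qscale.
Proof. by move=> p; rewrite -[p]repK -!clsZ scale1r. Qed.
Let qscaleDr : right_distributive qscale +%R.
Proof. by move=> k p q; rewrite -[p]repK -[q]repK -clsA -!clsZ -clsA scalerDr. Qed.
Let qscaleDl p : {morph qscale^~ p : k l / k + l}.
Proof. by move=> k l; rewrite -[p]repK -!clsZ -!clsA scalerDl. Qed.
HB.instance Definition _ := GRing.Zmodule_isLmodule.Build K quot
  qscaleA qscale1 qscaleDr qscaleDl.

Let clsX x y : cls (x * y) = cls x * cls y. Proof. exact: clsM. Qed.
Let clsS k x : cls (k *: x) = k *: cls x. Proof. exact: clsZ. Qed.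

Let qscaleAl k (p q : quot) : k *: (p * q) = (k *: p) * q.
Proof. by rewrite -[p]repK -[q]repK -clsX -!clsS -clsX scalerAl. Qed.
Let qscaleAr k (p q : quot) : k *: (p * q) = p * (k *: q).
Proof. by rewrite -[p]repK -[q]repK -clsX -!clsS -clsX scalerAr. Qed.
HB.instance Definition _ := GRing.LSemiModule_isLSemiAlgebra.Build K quot qscaleAl.
HB.instance Definition _ := GRing.LSemiAlgebra_isSemiAlgebra.Build K quot qscaleAr.

Let cls_linear : linear cls.
Proof. by move=> k x y; rewrite clsA clsS. Qed.
HB.instance Definition _ := GRing.isLinear.Build K A quot _ cls cls_linear.
Let cls_mul : GRing.monoid_morphism cls.
Proof. by split=> // x y; rewrite clsX. Qed.
HB.instance Definition _ := GRing.isMonoidMorphism.Build A quot cls cls_mul.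

Lemma cls_eq0 x : cls x = 0 <-> I x.
Proof. by rewrite -(rmorph0 cls) clsP subr0. Qed.

End IdealQuotient.

(** * Leavitt families and the reduction of homogeneous elements *)

Section Span.
Variables (K : fieldType) (Q : lmodType K).

Inductive span (B : Q -> Prop) : Q -> Prop :=
| span0 : span B 0
| spanS k b x : B b -> span B x -> span B (k *: b + x).

Lemma span_gen (B : Q -> Prop) b : B b -> span B b.
Proof.
rewrite -[b in span _ b]addr0 -[b in b + 0]scale1r => Bb.
by apply: spanS => //; apply: span0.
Qed.

Lemma spanD (B : Q -> Prop) x y : span B x -> span B y -> span B (x + y).
Proof.
move=> Bx By; elim: Bx => [|k b z Bb _ IH]; first by rewrite add0r.
by rewrite -addrA; apply: spanS.
Qed.

Lemma spanZ (B : Q -> Prop) k x : span B x -> span B (k *: x).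
Proof.
elim=> [|l b z Bb _ IH]; first by rewrite scaler0; apply: span0.
by rewrite scalerDr scalerA; apply: spanS.
Qed.

Lemma linear_at0 (Q' : lmodType K) (f : Q -> Q') : linear f -> f 0 = 0.
Proof.
move=> lf; have := lf 1 0 0; rewrite scaler0 addr0 scale1r.
by rewrite -{1}[f 0]addr0 => /addrI.
Qed.

End Span.

Lemma span_linear (K : fieldType) (Q Q' : lmodType K) (f : Q -> Q')
    (B : Q -> Prop) (B' : Q' -> Prop) x :
  linear f -> (forall b, B b -> span B' (f b)) -> span B x -> span B' (f x).
Proof.
move=> lf Bf; elim=> [|k b z Bb _ IH]; first by rewrite linear_at0 //; apply: span0.
by rewrite lf; apply: spanD => //; apply/spanZ/Bf.
Qed.

Lemma span_sub (K : fieldType) (Q : lmodType K) (B B' : Q -> Prop) x :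
  (forall b, B b -> B' b) -> span B x -> span B' x.
Proof.
by move=> BB'; apply: (@span_linear _ _ _ id) => // b /BB'; apply: span_gen.
Qed.

Section OrthogonalProjections.
Variables (K : fieldType) (Q : lmodType K) (I : eqType) (T : I -> Q -> Q).
Hypothesis T_linear : forall i, linear (T i).
Hypothesis T_orth : forall i j x, T i (T j x) = if i == j then T j x else 0.

(** Each generator is fixed by one projection and killed by all others. The freedom to enlarge [F]
    lets [ghost_free] pass to all edges leaving a vertex, where CK2 applies. *)
Lemma span_orth_sum (P : I -> Prop) x :
  span (fun b => exists2 i, P i & T i b = b) x ->
  exists F : seq I, (forall i, i \in F -> P i) /\
    forall F', uniq F' -> {subset F <= F'} -> x = \sum_(i <- F') T i x.
Proof.
elim=> [|k b y [i Pi Tib] _ [F [FP IH]]].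
  by exists [::]; split=> // F' _ _; rewrite big1 // => i _; apply: linear_at0.
exists (i :: F); split=> [j|F' uF' sF'].
  by rewrite in_cons => /orP[/eqP ->|/FP].
under eq_bigr => j _ do rewrite T_linear.
rewrite big_split /= -scaler_sumr -IH //; last first.
  by move=> j jF; apply: sF'; rewrite in_cons jF orbT.
congr (_ *: _ + _); rewrite (bigD1_seq i) ?sF' ?mem_head //= Tib.
rewrite big1 ?addr0 // => j ji.
by rewrite -Tib T_orth (negPf ji).
Qed.

Lemma span_orth_neq0 (P : I -> Prop) x :
  span (fun b => exists2 i, P i & T i b = b) x -> x <> 0 ->
  exists2 i, P i & T i x <> 0.
Proof.
move=> /span_orth_sum[F [FP Fx]] x0; apply: contrapT => H; apply: x0.
rewrite (Fx (undup F)) ?undup_uniq //; last by move=> i; rewrite mem_undup.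
rewrite big1_seq // => i /andP[_]; rewrite mem_undup => /FP Pi.
by apply: contrapT => Ti; apply: H; exists i.
Qed.

End OrthogonalProjections.

Section LeavittFamily.
Variables (G : graph) (K : fieldType) (Q : algType K).

(** Stated in an arbitrary unital algebra, to serve both $L_K(G)$ and its quotients; some [V v] may
    be 0. *)
Record leavitt_family (V : vert G -> Q) (E Es : edge G -> Q) : Prop := {
  lf_VV v : V v * V v = V v;
  lf_VV0 v w : v <> w -> V v * V w = 0;
  lf_VE e : V (src e) * E e = E e;
  lf_EV e : E e * V (rng e) = E e;
  lf_VEs e : V (rng e) * Es e = Es e;
  lf_EsV e : Es e * V (src e) = Es e;
  lf_EsE e : Es e * E e = V (rng e);
  lf_EsE0 e f : e <> f -> Es e * E f = 0;
  lf_CK2 v l : l <> [::] -> uniq l -> (forall e, e \in l <-> src e = v) ->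
    V v = \sum_(e <- l) E e * Es e
}.

Variables (V : vert G -> Q) (E Es : edge G -> Q).
Hypothesis lf : leavitt_family V E Es.

Let linMl a : linear (fun x : Q => a * x).
Proof. by move=> k x y; rewrite mulrDr scalerAr. Qed.
Let linMr a : linear (fun x : Q => x * a).
Proof. by move=> k x y; rewrite mulrDl scalerAl. Qed.

Definition EP (p : seq (edge G)) : Q := foldr (fun e x => E e * x) 1 p.
(** This is the adjoint of the path [q]: its ghost edges come in reverse order. *)
Definition GP (q : seq (edge G)) : Q := foldr (fun e x => x * Es e) 1 q.

Lemma EP_rcons p e : EP (rcons p e) = EP p * E e.
Proof. by elim: p => [|f p IH] /=; rewrite ?mulr1 ?mul1r // IH mulrA. Qed.

Let VVif u v : V u * V v = if u == v then V v else 0.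
Proof. by case: eqVneq => [->|/eqP uv]; rewrite ?(lf_VV lf) ?(lf_VV0 lf). Qed.

Lemma V_mul_E u e : V u * E e = if u == src e then E e else 0.
Proof. by rewrite -(lf_VE lf) mulrA VVif; case: eqP; rewrite ?mul0r. Qed.

Lemma Es_mul_V u e : Es e * V u = if src e == u then Es e else 0.
Proof.
by rewrite -(lf_EsV lf) -mulrA VVif; case: eqP => [->|]; rewrite ?mulr0.
Qed.

Lemma Es_mul_E e f : Es e * E f = if e == f then V (rng f) else 0.
Proof. by case: eqVneq => [->|/eqP ef]; rewrite ?(lf_EsE lf) ?(lf_EsE0 lf). Qed.

Lemma V_mul_EP u p w : V u * (EP p * V w) = 0 \/ V u * (EP p * V w) = EP p * V w.
Proof.
case: p => [|e p] /=; first by rewrite mul1r VVif; case: eqP; [right|left].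
by rewrite !mulrA V_mul_E; case: eqP; [right|left; rewrite !mul0r].
Qed.

(* Some [Es f] does not kill [z], and multiplying by it strips the first edge of
   every path occurring in [z]. *)
Lemma real_reduction m w z :
  span (fun b => exists2 p, size p = m & b = EP p * V w) z -> z <> 0 ->
  exists a, a * z = V w.
Proof.
elim: m z => [|m IH] z.
  move=> sz z0.
  have [k zk] : exists k, z = k *: V w.
    elim: sz => [|k b y [p /size0nil -> ->] _ [l ->]].
      by exists 0; rewrite scale0r.
    by exists (k + l); rewrite scalerDl mul1r.
  have k0 : k != 0 by apply/eqP => k0; apply: z0; rewrite zk k0 scale0r.
  by exists (k^-1 *: 1); rewrite zk -scalerAl mul1r scalerA mulVf // scale1r.
move=> sz z0.
have [|||f _ Tfz] := @span_orth_neq0 _ _ _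
    (fun f x => E f * Es f * x) _ _ (fun=> True) z _ z0.
- by move=> i; apply: linMl.
- move=> i j x; rewrite mulrA -[E i * Es i * _]mulrA [Es i * _]mulrA Es_mul_E.
  by case: eqP => [->|_]; rewrite ?mul0r ?mulr0 ?mul0r // !mulrA (lf_EV lf).
- apply: span_sub sz => b [[//|f p] _ ->]; exists f => //=.
  by rewrite -!mulrA [Es f * _]mulrA (lf_EsE lf) !mulrA (lf_EV lf).
have [||a aE] := IH (Es f * z).
- apply: span_linear (linMl _) _ sz => b [[//|g p] [pm] ->] /=.
  rewrite !mulrA Es_mul_E; case: eqP => [_|_]; last by rewrite !mul0r; apply: span0.
  rewrite -mulrA; case: (V_mul_EP (rng g) p w) => ->; first exact: span0.
  by apply: span_gen; exists p.
- by move=> H; apply: Tfz; rewrite -mulrA H mulr0.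
by exists (a * Es f); rewrite -mulrA.
Qed.

(** The monomial $pq^*$. The vertex is explicit because an empty path evaluates to 1. *)
Definition mono p v q : Q := EP p * V v * GP q.

Lemma mono_mul_V p v q u : mono p v q * V u = 0 \/ mono p v q * V u = mono p v q.
Proof.
rewrite /mono; case: q => [|f q] /=.
  rewrite mulr1 -mulrA VVif; case: eqP => [->|_]; first by right.
  by left; rewrite mulr0.
rewrite -!mulrA Es_mul_V; case: eqP => _; first by right.
by left; rewrite !mulr0.
Qed.

(** The bound [N] on the ghost length is the induction measure of the reduction. *)
Definition hmono (n : int) (N : nat) (b : Q) : Prop :=
  exists p v q,
    [/\ (size p)%:Z = (size q)%:Z + n, (size q <= N)%N & b = mono p v q].

(** The edge cancels against the last ghost factor or, when there is none, lengthens the real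
    path. *)
Lemma hmono_mul_E n N b f :
  hmono n N b -> b * E f = 0 \/ hmono (n + 1) N.-1 (b * E f).
Proof.
move=> [p [v [[|g q] [pq qN ->]]]]; rewrite {1 2}/mono /=.
  rewrite mulr1 -mulrA V_mul_E; case: eqP => _; last by left; rewrite mulr0.
  right; exists (rcons p f), (rng f), [::].
  rewrite /mono EP_rcons size_rcons mulr1 -mulrA (lf_EV lf); split=> //.
  by move: pq => /=; lia.
rewrite -!mulrA Es_mul_E; case: eqP => _; last by left; rewrite !mulr0.
rewrite !mulrA -/(mono p v q); case: (mono_mul_V p v q (rng f)) => ->.
  by left.
right; exists p, v, q; split=> //=; move: pq qN => /=; first by lia.
by case: N.
Qed.

Lemma hmono_widen n N N' b : (N <= N')%N -> hmono n N b -> hmono n N' b.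
Proof.
move=> NN' [p [v [q [? qN ?]]]]; exists p, v, q; split=> //.
exact: leq_trans NN'.
Qed.

Lemma span_mul_E n N x f :
  span (hmono n N) x -> span (hmono (n + 1) N.-1) (x * E f).
Proof.
apply: (span_linear (linMr (E f))) => b.
by move=> /(hmono_mul_E f)[->|]; [apply: span0|apply: span_gen].
Qed.

Lemma span_V_neq0 n N x : span (hmono n N) x -> x <> 0 -> exists w, x * V w <> 0.
Proof.
move=> sx x0.
have [|||w _ ?] := @span_orth_neq0 _ _ _
    (fun w x => x * V w) _ _ (fun=> True) x _ x0.
- by move=> i; apply: linMr.
- by move=> i j y; rewrite -mulrA VVif eq_sym; case: eqP => [->|_]; rewrite ?mulr0.
- apply: span_sub sx => b [p [v [[|f q] [_ _ ->]]]]; rewrite /mono /=.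
    by exists v => //; rewrite mulr1 -mulrA (lf_VV lf).
  by exists (src f) => //; rewrite -!mulrA (lf_EsV lf).
by exists w.
Qed.

Definition gen (l : letter G) : Q :=
  match l with LV v => V v | LE e => E e | LG e => Es e end.
Definition word_val (w : word G) : Q := \prod_(l <- w) gen l.

Lemma hmono_mul_gen n N b l : hmono n N b ->
  b * gen l = 0 \/ hmono (n + deg_letter l) N.+1 (b * gen l).
Proof.
case: l => [v|e|e] /= hb.
- move: (hb) => [p [t [q [_ _ E1]]]]; case: (mono_mul_V p t q v) => E2.
    by left; rewrite E1.
  by right; rewrite E1 E2 -E1 addr0; apply: hmono_widen hb; lia.
- case: (hmono_mul_E e hb) => [|hb']; [by left | right].
  by apply: hmono_widen hb'; lia.
- move: hb => [p [t [q [pq qN ->]]]]; right.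
  by exists p, t, (e :: q); rewrite /mono /= mulrA; split=> //; lia.
Qed.

Lemma deg_rcons (w : word G) l : deg (rcons w l) = deg w + deg_letter l.
Proof. by elim: w => [|l' w IH] /=; rewrite ?addr0 ?add0r // IH addrA. Qed.

(** Letters are appended one by one on the right. The empty word is excluded because its value 1
    need not be a monomial. *)
Lemma word_val_mono w : w <> [::] ->
  word_val w = 0 \/ hmono (deg w) (size w) (word_val w).
Proof.
elim/last_ind: w => [//|w l IH] _; rewrite /word_val.
have [->|/eqP w0] := eqVneq w [::].
  rewrite big_cons big_nil mulr1; case: l => [v|e|e] /=; right.
  - by exists [::], v, [::]; rewrite /mono /= mul1r mulr1.
  - by exists [:: e], (rng e), [::]; rewrite /mono /= !mulr1 (lf_EV lf).
  - by exists [::], (rng e), [:: e]; rewrite /mono /= !mul1r (lf_VEs lf).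
rewrite deg_rcons size_rcons big_rcons /= -/(word_val w).
case: (IH w0) => [->|/(hmono_mul_gen l)//]; by left; rewrite mul0r.
Qed.

Lemma EP_path u p w : V u * (EP p * V w) <> 0 -> is_path p u w.
Proof.
elim: p u => [|e p IH] u /=; first by rewrite mul1r VVif; case: eqP.
rewrite !mulrA V_mul_E; case: eqP => [->|]; last by rewrite !mul0r.
rewrite -(lf_EV lf) -!mulrA => H; split=> //; apply: IH => H0.
by apply: H; rewrite H0 mulr0.
Qed.

Lemma GP_path u q w : (V w * GP q) * V u <> 0 -> is_path q u w.
Proof.
elim: q u => [|e q IH] u /=; first by rewrite mulr1 VVif eq_sym; case: eqP.
rewrite -!mulrA Es_mul_V; case: eqP => [->|]; last by rewrite !mulr0.
rewrite -(lf_VEs lf) => H; split=> //; apply: IH => H0.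
by apply: H; rewrite !mulrA H0 mul0r.
Qed.

(** The product is a nonzero monomial $pq^*$; then [p] runs from [u], and [q] from [v], to the same
    vertex. *)
Lemma word_common_descendant u v w : V u * word_val w * V v <> 0 ->
  exists2 t, reach u t & reach v t.
Proof.
move=> H; have : word_val (LV u :: rcons w (LV v)) <> 0.
  by rewrite /word_val big_cons big_rcons /= mulrA.
case: (@word_val_mono (LV u :: rcons w (LV v))) => // [[p [t [q [_ _ E1]]]]].
have E2 : V u * mono p t q * V v = mono p t q.
  rewrite -E1 /word_val big_cons big_rcons /= !mulrA (lf_VV lf).
  by rewrite -!mulrA (lf_VV lf).
rewrite E1 -E2 => m0; exists t.
  exists p; apply: EP_path => H0; apply: m0.
  by rewrite /mono !mulrA -(mulrA (V u)) H0 !mul0r.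
exists q; apply: GP_path => H0; apply: m0.
by rewrite /mono -!mulrA (mulrA (V t)) H0 !mulr0.
Qed.

Lemma common_descendant u v a : span (fun b => exists w, b = word_val w) a ->
  V u * a * V v <> 0 -> exists2 t, reach u t & reach v t.
Proof.
elim=> [|k b x [w ->] _ IH]; first by rewrite mulr0 mul0r.
rewrite mulrDr mulrDl -scalerAr -scalerAl => H.
have [H0|/eqP] := eqVneq (V u * word_val w * V v) 0.
  by apply: IH => H1; apply: H; rewrite H0 H1 scaler0 addr0.
exact: word_common_descendant.
Qed.

Lemma V_hereditary e : V (src e) = 0 -> V (rng e) = 0.
Proof.
by move=> H; rewrite -(lf_EsE lf) -(lf_EsV lf) H mulr0 mul0r.
Qed.

Lemma V_saturated v l : l <> [::] -> uniq l -> (forall e, e \in l <-> src e = v) ->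
  (forall e, src e = v -> V (rng e) = 0) -> V v = 0.
Proof.
move=> l0 ul lv rv; rewrite (lf_CK2 lf l0 ul lv) big1_seq // => e /andP[_ /lv ev].
by rewrite -(lf_EV lf) (rv _ ev) mulr0 mul0r.
Qed.

Let realb w n b := exists2 p : seq (edge G), (size p)%:Z = n & b = EP p * V w.
(** Of a monomial ending in a ghost edge, only its invariance under the projection of that edge is
    kept. *)
Let ghostb w b := exists2 f, src f = w & b * (E f * Es f) = b.

Lemma span_split n N x w : span (hmono n N) x ->
  exists z y, [/\ span (realb w n) z, span (ghostb w) y & x * V w = z + y].
Proof.
elim=> [|k b y [p [v [[|f q] [pq _ ->]]]] _ [z [t [sz st E1]]]].
- by exists 0, 0; rewrite addr0 mul0r; split=> //; apply: span0.
- have [vw|vw] := eqVneq v w; last first.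
    exists z, t; split=> //; rewrite mulrDl E1 -scalerAl /mono mulr1 -mulrA.
    by rewrite VVif (negPf vw) mulr0 scaler0 add0r.
  exists (k *: (EP p * V w) + z), t; split=> //.
    by apply: spanS => //; exists p => //; rewrite pq add0r.
  by rewrite mulrDl E1 -scalerAl /mono mulr1 -mulrA VVif vw eqxx addrA.
- have [fw|fw] := eqVneq (src f) w; last first.
    exists z, t; split=> //; rewrite mulrDl E1 -scalerAl /mono /=.
    by rewrite -!mulrA Es_mul_V (negPf fw) !mulr0 scaler0 add0r.
  exists z, (k *: mono p v (f :: q) + t); split=> //.
    apply: spanS => //; exists f => //; rewrite /mono /= -!mulrA.
    by rewrite [Es f * (E f * _)]mulrA (lf_EsE lf) (lf_VEs lf).
  have mV : mono p v (f :: q) * V w = mono p v (f :: q).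
    by rewrite /mono /= -!mulrA -fw (lf_EsV lf).
  by rewrite mulrDl E1 -scalerAl mV addrCA.
Qed.

Lemma span_realb_reduction n w z : span (realb w n) z -> z <> 0 ->
  exists a, a * z = V w.
Proof.
case: n => m sz z0.
  by apply: (@real_reduction m) z0; apply: span_sub sz => b [p [pm] ->]; exists p.
(* For negative [n] there is no path of length [n], so [z] is 0. *)
case: z0; elim: sz => [//|k b y [p pm _]]; by [].
Qed.

(** This rules out breaking vertices: subtracting from such a [w] the finitely many surviving $ee^*$
    could leave a nonzero homogeneous element that generates no nonzero vertex. *)
Hypothesis infinite_emission : forall w (l : seq (edge G)),
  V w <> 0 -> infinite_emitter w ->
  exists e, [/\ src e = w, e \notin l & V (rng e) <> 0].

(* If an element [x * V w] has no ghost-shortening multiple [x * V w * E f] then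
   it coincides with its ghost-free part: otherwise an edge avoiding the finitely
   many ghost edges occurring in [x], or relation CK2 when there is no such edge,
   makes it vanish. *)
Lemma ghost_free n N x w : span (hmono n N) x -> x * V w <> 0 ->
  (forall f, x * V w * E f = 0) -> span (realb w n) (x * V w).
Proof.
move=> sx xw0 xE0; have [z [y [sz sy xzy]]] := span_split w sx.
have zV : z * V w = z.
  elim: sz => [|k b t [p _ ->] _ IH]; first by rewrite mul0r.
  by rewrite mulrDl IH -scalerAl -mulrA (lf_VV lf).
have [||F [Fw Fy]] := @span_orth_sum _ _ _
    (fun f x => x * (E f * Es f)) _ _ (fun f => src f = w) y sy.
- by move=> i; apply: linMr.
- move=> i j t; rewrite -!mulrA [Es j * _]mulrA Es_mul_E eq_sym.
  case: eqP => [->|_]; first by rewrite (lf_VEs lf).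
  by rewrite mul0r !mulr0.
(* As every edge kills $z+y$, the ghost part [y] is determined by [z]. *)
have xw F' : uniq F' -> {subset F <= F'} ->
    x * V w = z - \sum_(f <- F') z * (E f * Es f).
  move=> uF' sF'; rewrite xzy {1}(Fy F') // -sumrN; congr (_ + _).
  apply: eq_bigr => f _; apply/eqP; rewrite -subr_eq0 opprK -mulrDl addrC -xzy.
  by rewrite mulrA xE0 mul0r.
have xw_undup := xw (undup F) (undup_uniq _) (fun i => etrans (mem_undup F i)).
(* Such an [f] misses all ghost edges of [y], so $zf=0$; if [z] were nonzero, it would reduce to [w]
   and force $f=0$. *)
have [[f [fw fF rf]]|noedge] :=
  pselect (exists f, [/\ src f = w, f \notin F & V (rng f) <> 0]).
  suff z0 : z = 0.
    by case: xw0; rewrite xw_undup z0 sub0r big1 ?oppr0 // => i _; rewrite mul0r.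
  apply: contrapT => z0; have [a az] := span_realb_reduction sz z0.
  have zf0 : z * E f = 0.
    rewrite -(xE0 f) xw_undup mulrBl mulr_suml big1_seq ?subr0 // => g.
    rewrite mem_undup => /andP[_ gF]; rewrite -!mulrA Es_mul_E.
    by case: eqP fF => [<-|]; rewrite ?gF ?mulr0.
  apply: rf; rewrite -(lf_EsE lf) -(lf_VE lf) fw -az.
  by rewrite -!mulrA zf0 !mulr0.
have nie : ~ infinite_emitter w.
  have Vw0 : V w <> 0 by move=> Vw0; apply: xw0; rewrite Vw0 mulr0.
  by move=> /(infinite_emission F Vw0)[f fP]; apply: noedge; exists f.
have [l lw] : exists l : list (edge G), forall e, src e = w -> In e l.
  exact: contrapT.
pose L := undup [seq e <- F ++ l | src e == w].
have memL e : e \in L <-> src e = w.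
  rewrite mem_undup mem_filter mem_cat; split=> [/andP[/eqP //]|ew].
  by rewrite ew eqxx /=; apply/orP; right; apply/In_mem/lw.
have FL : {subset F <= L} by move=> f /Fw fw; apply/memL.
(* A sink leaves no ghost part. Otherwise [L] lists all edges leaving [w], and CK2 turns the formula
   into $z-z=0$. *)
have [L0|/eqP L0] := eqVneq L [::].
  by rewrite (xw L (undup_uniq _) FL) L0 big_nil subr0.
case: xw0; rewrite (xw L (undup_uniq _) FL) -mulr_sumr.
by rewrite -(lf_CK2 lf L0 (undup_uniq _) memL) zV subrr.
Qed.

(** Induction on the ghost length: an edge that does not kill [x * V w] lowers it; if there is none,
    [ghost_free] applies. *)
Theorem homogeneous_reduction n N x : span (hmono n N) x -> x <> 0 ->
  exists a b v, V v <> 0 /\ a * x * b = V v.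
Proof.
elim: N n x => [|N IH] n x sx x0; have [w xw0] := span_V_neq0 sx x0.
all: have Vw0 : V w <> 0 by move=> Vw0; apply: xw0; rewrite Vw0 mulr0.
  have /span_realb_reduction/(_ xw0)[a axw] : span (realb w n) (x * V w).
    apply: span_linear (linMr _) _ sx => b [p [v [[|f q] [pq //= _ ->]]]].
    rewrite /mono mulr1 -mulrA VVif; case: eqP => [_|_].
      by apply: span_gen; exists p => //; rewrite pq add0r.
    by rewrite mulr0; apply: span0.
  by exists a, (V w), w; split=> //; rewrite -mulrA.
have [[f xf0]|H] := pselect (exists f, x * V w * E f <> 0).
  move: xf0; rewrite -mulrA V_mul_E; case: eqP => [_|_]; last by rewrite mulr0.
  move=> /(IH _ _ (span_mul_E f sx))[a [b [v [Vv avb]]]].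
  by exists a, (E f * b), v; split=> //; rewrite -avb !mulrA.
have /span_realb_reduction/(_ xw0)[a axw] : span (realb w n) (x * V w).
  apply: (ghost_free sx) => // f; apply: contrapT => xf; apply: H.
  by exists f.
by exists a, (V w), w; split=> //; rewrite -mulrA.
Qed.

End LeavittFamily.

(** * The graph condition *)

Section GraphTheory.
Variable G : graph.
Implicit Types (u v w : vert G) (e f : edge G) (p q : list (edge G)).
Implicit Types (H Y : vert G -> Prop).

Definition hereditary H := forall e, H (src e) -> H (rng e).

(** The enumeration of the emitted edges is an argument because CK2 sums over it. *)
Definition regular v (l : seq (edge G)) :=
  [/\ l <> [::], uniq l & forall e, e \in l <-> src e = v].

Definition saturated H := forall v l,
  regular v l -> (forall e, src e = v -> H (rng e)) -> H v.

Definition escaping := forall H, hereditary H -> saturated H ->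
  forall v, ~ H v -> exists2 d, reach v d & ~ R_of H d.

Lemma is_path_cat p q u w :
  is_path (p ++ q) u w <-> exists2 v, is_path p u v & is_path q v w.
Proof.
elim: p u => [|e p IH] u /=; first by split=> [|[v ->]//]; exists u.
split=> [[-> /IH[v]]|[v [-> ep] qp]]; first by exists v.
by split=> //; apply/IH; exists v.
Qed.

Lemma reach_refl u : reach u u. Proof. by exists [::]. Qed.

Lemma reach_trans v u w : reach u v -> reach v w -> reach u w.
Proof. by move=> [p up] [q vq]; exists (p ++ q); apply/is_path_cat; exists v. Qed.

Lemma reach_edge e : reach (src e) (rng e). Proof. by exists [:: e]. Qed.

Lemma hereditary_reach H u v : hereditary H -> H u -> reach u v -> H v.
Proof.
move=> hH + [p]; elim: p u => [|e p IH] u /= Hu; first by move=> <-.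
by move=> [eu]; apply: IH; apply: hH; rewrite eu.
Qed.

Lemma not_uniq_map (T : eqType) (T' : eqType) (h : T -> T') (s : seq T) :
  ~~ uniq (map h s) ->
  exists s1 a s2 b s3, s = s1 ++ a :: s2 ++ b :: s3 /\ h a = h b.
Proof.
elim: s => [//|a s IH] /=; rewrite negb_and negbK => /orP[/mapP[b bs ab]|/IH].
  have [s2 s3] := splitPr bs.
  by exists [::], a, s2, b, s3.
by move=> [s1 [c [s2 [b [s3 [-> cb]]]]]]; exists (a :: s1), c, s2, b, s3.
Qed.

(** While two edges share a source, the segment between them can be cut out; the path stays nonempty
    and based at [u]. *)
Lemma closed_path_cycle u e : src e = u -> reach (rng e) u ->
  exists2 c, is_cycle c & on_cycle c u.
Proof.
move=> eu [p0 pe].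
have [p [n [pn p_n0 pu]]] :
    exists p n, [/\ (size p <= n)%N, p <> [::] & is_path p u u].
  by exists (e :: p0), (size p0).+1.
elim: n p pn p_n0 pu => [|n IH] p; first by rewrite leqn0 => /nilP.
move=> pn p_n0 pu; have [up|nup] := boolP (uniq (map (@src G) p)).
  exists p; case: p p_n0 pu {pn} up => [//|f p] _ [fu pf] up; last by left.
  by exists f, p; split=> //=; split; [rewrite fu | apply/NoDup_uniq].
move: (not_uniq_map nup) => [s1 [a [s2 [b [s3 [ps ab]]]]]]; subst p.
apply: (IH (s1 ++ b :: s3)).
- by move: pn; rewrite !size_cat /= size_cat /=; lia.
- by case: (s1).
move: pu => /is_path_cat[v s1v] /= [av /is_path_cat[w _ [bw s3w]]].
by apply/is_path_cat; exists v => //=; split=> //; rewrite -ab.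
Qed.

Lemma cycle_root c : is_cycle c ->
  exists r, forall e, e \in c -> reach r (src e) /\ reach (rng e) r.
Proof.
move=> [e0 [c' [_ [cp _]]]]; exists (src e0) => e ec.
move: cp; case/splitPr: ec => s1 s2 /is_path_cat[v s1v /= [ev s2v]].
by subst v; split; [exists s1 | exists s2].
Qed.

Lemma on_cycleP c v : on_cycle c v <-> exists2 e, e \in c & src e = v.
Proof.
rewrite /on_cycle; split=> [/In_mem/mapP[e ec ->]|[e ec <-]]; first by exists e.
by apply/In_mem/map_f.
Qed.

Lemma cycle_reach c u v : is_cycle c -> on_cycle c u -> on_cycle c v -> reach u v.
Proof.
move=> /cycle_root[r cr] /on_cycleP[e ec <-] /on_cycleP[f fc <-].
have [_ er] := cr _ ec; have [rf _] := cr _ fc.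
by apply: reach_trans (reach_trans er rf); apply: reach_edge.
Qed.

Lemma cycle_edge_reach c e v : is_cycle c -> e \in c -> on_cycle c v ->
  reach (rng e) v.
Proof.
move=> /cycle_root[r cr] ec /on_cycleP[f fc <-].
have [_ er] := cr _ ec; have [rf _] := cr _ fc.
exact: reach_trans er rf.
Qed.

Definition cond_a := forall c, is_cycle c -> ~ @has_exit G c \/ extreme c.
Definition cond_b := forall v, infinite_emitter v ->
  exists c, is_cycle c /\ on_cycle c v.

(** A cycle with exits is extreme, so the one-edge path [e] can be continued back to the cycle. *)
Lemma exit_returns c e : cond_a -> is_cycle c -> on_cycle c (src e) ->
  has_exit c -> reach (rng e) (src e).
Proof.
move=> ca cc ce he; have [//|[_ /(_ [:: e] (src e) (rng e) ce)]] := ca _ cc.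
case=> // q [w [qw cw]]; apply: (@reach_trans w); first by exists q.
exact: cycle_reach cc cw ce.
Qed.

(** The cycle through an infinite emitter has finitely many edges, hence an exit. *)
Lemma infinite_emitter_returns e : cond_a -> cond_b ->
  infinite_emitter (src e) -> reach (rng e) (src e).
Proof.
move=> ca cb ie; have [c [cc ce]] := cb _ ie.
apply: (exit_returns ca cc ce); apply: contrapT => nex; apply: ie.
exists c => f fe; apply: contrapT => nf; apply: nex.
by exists f; rewrite /is_exit fe.
Qed.

Lemma finite_emitter_regular v e : src e = v -> ~ infinite_emitter v ->
  exists l, regular v l.
Proof.
move=> ev /contrapT[l lv]; pose L := undup [seq f <- l | src f == v].
have memL f : f \in L <-> src f = v.
  rewrite mem_undup mem_filter; split=> [/andP[/eqP]//|fv].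
  by rewrite fv eqxx; apply/In_mem/lv.
exists L; split=> //; last exact: undup_uniq.
by move=> L0; have /memL := ev; rewrite L0.
Qed.

(** Infinite pigeonhole: elements that occur only up to some bound are discarded from [l]. *)
Lemma recurrent_element (T : Type) (l : list T) (P : nat -> T -> Prop) :
  (forall n, exists m t, [/\ (n <= m)%N, In t l & P m t]) ->
  exists t, forall n, exists2 m, (n <= m)%N & P m t.
Proof.
elim: l => [|t l IH] Pl; first by have [m [t []]] := Pl 0.
have [|nt] := pselect (forall n, exists2 m, (n <= m)%N & P m t); first by exists t.
have [N tN] : exists N, forall m, (N <= m)%N -> ~ P m t.
  apply: contrapT => H; apply: nt => n; apply: contrapT => H1; apply: H.
  by exists n => m nm Pm; apply: H1; exists m.
apply: IH => n; have [m [s [nm [ts|sl] Pm]]] := Pl (maxn n N).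
  by case: (tN m); rewrite ?ts //; lia.
by exists m, s; split=> //; lia.
Qed.

Definition reaches_within H k u := exists p w, [/\ is_path p u w, H w & (size p <= k)%N].

(** The first edge of a shortest path to [H] works for every [k] at once. *)
Lemma closer_step H u : ~ H u -> R_of H u ->
  exists2 f, src f = u & forall k, reaches_within H k u -> reaches_within H k.-1 (rng f).
Proof.
move=> nHu [h [Hh [p0 up0]]].
have : reaches_within H (size p0) u by exists p0, h.
elim: (size p0) => [|k IH].
  by move=> [[|f p] [w []]] //= uw Hw; case: nHu; rewrite uw.
move=> nk; have [/IH//|nnk] := pselect (reaches_within H k u).
move: nk => [[|f p] [w [/= up Hw pk]]]; first by subst.
case: up => fu up; exists f => // j [q [w' [uq Hw' qj]]].
exists p, w; split=> //.
suff : (size p < j)%N by lia.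
rewrite ltnNge; apply/negP => jp; apply: nnk.
by exists q, w'; split=> //; lia.
Qed.

Lemma condition2_escaping : condition2 G -> escaping.
Proof.
move=> [ca [cb cc]] H hH sH v0 nHv0; apply: contrapT => no_d.
have reachH d : reach v0 d -> R_of H d.
  by move=> vd; apply: contrapT => nd; apply: no_d; exists d.
pose good u := reach v0 u /\ ~ H u.
(* The path stays outside [H]; it approaches [H] at every vertex that has no edge into [H]. *)
pose stepP u f := [/\ src f = u, ~ H (rng f) &
    (exists2 e, src e = u & H (rng e)) \/
    (forall k, reaches_within H k u -> reaches_within H k.-1 (rng f))].
have step u : good u -> exists f, stepP u f.
  move=> [vu nHu]; have [[e eu He]|noe] := pselect (exists2 e, src e = u & H (rng e)).
    (* An edge from an infinite emitter returns to it, which would put [u] in [H]. *)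
    have nie : ~ infinite_emitter u.
      move=> ie; apply: nHu; apply: (hereditary_reach hH He).
      by rewrite -eu; apply: infinite_emitter_returns => //; rewrite eu.
    have [l ul] := finite_emitter_regular eu nie.
    suff [f fu nHf] : exists2 f, src f = u & ~ H (rng f).
      by exists f; split=> //; left; exists e.
    apply: contrapT => nof; apply: nHu; apply: sH ul _ => f fu.
    by apply: contrapT => nHf; apply: nof; exists f.
  have [f fu fk] := closer_step nHu (reachH _ vu).
  by exists f; split=> // [Hf|]; [apply: noe; exists f | right].
(* [None] is a default at vertices that are not good. *)
have /choice[nx nxP] : forall u, exists o : option (edge G), good u ->
    exists2 f, o = Some f & stepP u f.
  move=> u.
  have [/step[f fP]|ngu] := pselect (good u); last by exists None.
  by exists (Some f) => _; exists f.
pose nv u := if nx u is Some f then rng f else u.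
pose U n := iter n nv v0.
have goodU n : good (U n).
  elim: n => [|n IH]; first by split=> //; apply: reach_refl.
  have [f nf [fU nHf _]] := nxP _ IH; rewrite /U iterS -/(U n) /nv nf; split=> //.
  by apply: (reach_trans IH.1); rewrite -fU; apply: reach_edge.
have /choice[a aP] : forall n, exists f, nx (U n) = Some f.
  by move=> n; have [f nf _] := nxP _ (goodU n); exists f.
have aU n : src (a n) = U n.
  by have [f] := nxP _ (goodU n); rewrite aP => -[<-] [].
have aUS n : rng (a n) = U n.+1 by rewrite /U iterS -/(U n) /nv aP.
have aip : is_infinite_path a by move=> n; rewrite aU aUS.
(* The distance to [H] drops until a vertex with an edge into [H] is met. *)
have U_edge k n : reaches_within H k (U n) ->
    exists m e, [/\ (n <= m)%N, src e = U m & H (rng e)].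
  elim: k n => [|k IH] n nk.
      by move: nk => [[|f p] [w []]] //= Uw Hw; have [_] := goodU n; rewrite Uw.
  have [f nf [_ _ [[e eU He]|near]]] := nxP _ (goodU n).
    by exists n, e.
  have fa : f = a n by move: nf; rewrite aP => -[].
  move: (near _ nk); rewrite fa aUS => /IH[m [e [nm eU He]]].
  by exists m, e; split=> //; lia.
have [l lP] := cc _ aip.
(* [H] cannot reach the path, so by (c) the edges from the path into [H] are finite in number. *)
have [e eP] : exists e, forall n, exists2 m, (n <= m)%N & src e = U m /\ H (rng e).
  apply: (@recurrent_element _ l) => n.
  have [h [Hh [p Up]]] := reachH _ (goodU n).1.
  have [|m [e [nm eU He]]] := @U_edge (size p) n; first by exists p, h.
  exists m, e; split=> //; apply: lP; first by exists m; left; rewrite aU.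
  move=> [w [[k kw] ew]]; have Hw := hereditary_reach hH He ew.
  by move: kw; rewrite aU aUS => -[] kw; move: Hw; rewrite -kw; have [] := goodU k;
     have [] := goodU k.+1.
have [m _ [em He]] := eP 0; have [m' mm' [em' _]] := eP m.+1.
have reachU i j : reach (U i) (U (i + j)%N).
  elim: j => [|j IH]; first by rewrite addn0; apply: reach_refl.
  by apply: (reach_trans IH); rewrite addnS -aUS -aU; apply: reach_edge.
(* The source of [e] occurs twice, so it lies on a cycle; [e] is an exit of it that cannot return
   from [H]. *)
have [|c cyc cU] := @closed_path_cycle (U m) (a m) (aU m).
  by rewrite aUS -em em' -(subnKC mm'); apply: reachU.
have eU : ~ reach (rng e) (U m).
  by move=> eU; have [_] := goodU m; apply; apply: hereditary_reach eU.
apply: (eU); rewrite -em; apply: (exit_returns ca cyc); first by rewrite em.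
exists e; split; first by rewrite em.
by move/In_mem => ec; apply: eU; apply: cycle_edge_reach cU.
Qed.

(** [escaping] is applied to the complement of [R_of Y]: for a path of positive length into [Y],
    saturation follows from its second vertex, and for [u] in [Y] from the hypothesis. *)
Lemma escaping_return Y y : escaping ->
  (forall u l, Y u -> regular u l -> exists2 e, src e = u & R_of Y (rng e)) ->
  Y y -> exists2 d, reach y d & forall d', reach d d' -> R_of Y d'.
Proof.
move=> esc Yreg Yy; have [|||d yd nd] := esc (fun u => ~ R_of Y u) _ _ y.
- move=> e + [v [Yv rv]]; apply; exists v; split=> //.
  exact: reach_trans (reach_edge e) rv.
- move=> v l vl vY [u [Yu [[|e p] /= vp]]].
    by subst u; have [e /vY] := Yreg _ _ Yu vl.
  by case: vp => ev ep; apply: (vY _ ev); exists u; split=> //; exists p.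
- by apply; exists y; split=> //; apply: reach_refl.
exists d => // d' dd'; apply: contrapT => nd'; apply: nd.
by exists d'.
Qed.

Lemma escaping_condition2 : escaping -> condition2 G.
Proof.
move=> esc; have ca : cond_a.
  move=> c cc; have [he|] := pselect (has_exit c); [right; split=> // | by left].
  move=> p u v cu pu; have [|d ud dP] := escaping_return (Y := on_cycle c) esc _ cu.
    move=> w l /on_cycleP[e ec ew] _; exists e => //; exists u; split=> //.
    exact: cycle_edge_reach cc ec cu.
  (* From [d] one reaches the cycle, then [u], then [v]; so [v] is a descendant of [d]. *)
  have [w [cw [q qw]]] : R_of (on_cycle c) v.
    apply: (dP); have [w [cw dw]] := dP _ (reach_refl d).
    apply: (reach_trans dw); apply: (reach_trans (cycle_reach cc cw cu)).
    by exists p.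
  by exists q, w.
have cb : cond_b.
  move=> v ie; have [e ev] : exists e, src e = v.
    by apply: contrapT => ne; apply: ie; exists [::] => e ev; case: ne; exists e.
  (* The condition on regular vertices holds vacuously for an infinite emitter. *)
  have [|d vd dP] := escaping_return (Y := eq v) (y := v) esc _ erefl.
    by move=> u l <- [_ _ lv]; case: ie; exists l => f /lv /In_mem.
  suff [f fv fr] : exists2 f, src f = v & reach (rng f) v.
    by have [c ? ?] := closed_path_cycle fv fr; exists c.
  have toV u : reach d u -> reach u v by move=> /dP[_ [<-]].
  case: vd => -[|f p] /= vd; last first.
    by exists f; [case: vd | apply: (@reach_trans d);
       [exists p; case: vd | apply/toV/reach_refl]].
  by subst d; exists e => //; apply: toV; rewrite -ev; apply: reach_edge.
split=> //; split=> // a aip; pose Y := inf_path_verts a.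
have Ysrc y : Y y -> exists n, y = src (a n).
  by move=> [n [<-|<-]]; [exists n | exists n.+1].
have reach_a m n : reach (src (a m)) (src (a (m + n)%N)).
  elim: n => [|n IH]; first by rewrite addn0; apply: reach_refl.
  by apply: (reach_trans IH); rewrite addnS -aip; apply: reach_edge.
have [||d _ dP] := escaping_return (Y := Y) (y := src (a 0)) esc; last first.
- have [y [/Ysrc[k ->] dk]] := dP _ (reach_refl d).
  (* From index [k] on, the vertices of [a] are descendants of [d], so all their edges lead back to
     [Y]. *)
  have bad e n : ~ R_of Y (rng e) -> src e = src (a n) -> (n < k)%N.
    move=> + en; apply: contra_notT; rewrite -leqNgt => /subnKC kn; apply: dP.
    apply: (reach_trans dk); apply: (reach_trans (reach_a k (n - k)%N)).
    by rewrite kn -en; apply: reach_edge.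
  (* At an infinite emitter every edge returns, by (a) and (b), so there is nothing to list. *)
  have fin n : exists l : list (edge G), forall e,
      src e = src (a n) -> ~ R_of Y (rng e) -> In e l.
    have [ie|/contrapT[l ln]] := pselect (infinite_emitter (src (a n))); last first.
      by exists l => e /ln.
    exists [::] => e en; case; exists (src (a n)); split; first by exists n; left.
    by rewrite -en; apply: infinite_emitter_returns => //; rewrite en.
  have [l lP] : exists l : list (edge G), forall e n, (n < k)%N ->
      src e = src (a n) -> ~ R_of Y (rng e) -> In e l.
    elim: k {dk bad} => [|k [l lk]]; first by exists [::].
    have [l' l'k] := fin k; exists (l ++ l') => e n.
    rewrite ltnS leq_eqVlt => /orP[/eqP ->|nk] en eY; apply/In_mem; rewrite mem_cat.
      by apply/orP; right; apply/In_mem/l'k.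
    by apply/orP; left; apply/In_mem/(lk e n).
  by exists l => e /Ysrc[n en] eY; apply: (lP _ n) => //; apply: bad eY en.
- by exists 0; left.
- move=> u l /Ysrc[n ->] _; exists (a n) => //.
  by exists (rng (a n)); split; [exists n; right | apply: reach_refl].
Qed.

End GraphTheory.

(** * Graded ideals and annihilators *)

Section FreeAlgebra.
Variables (G : graph) (K : fieldType).
Implicit Types (x y z : F0 G K) (w : word G) (k : K) (I J S : F0 G K -> Prop).

(** Unlike [fsupp], this admits constant terms, which makes the free algebra unital. *)
Definition finite_support : pred (F0 G K) :=
  fun x => `[< exists s : seq (word G), forall w, x w <> 0 -> w \in s >].

Lemma fsuppP x : fsupp x <-> x [::] = 0 /\ x \in finite_support.
Proof.
by split=> -[x0]; [move=> [s xs]|move=> /asboolP[s xs]]; split=> //;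
   [apply/asboolP|]; exists s => w /xs; move/In_mem.
Qed.

Lemma mon_fin w : mon K w \in finite_support.
Proof. by apply/asboolP; exists [:: w] => u; rewrite monE inE; case: eqP. Qed.

Lemma finite_support_subalg : GRing.subalg_closed finite_support.
Proof.
split; first exact: (mon_fin [::]).
  move=> k x y /asboolP[s xs] /asboolP[t yt]; apply/asboolP; exists (s ++ t) => w.
  rewrite addFE scaleFE mem_cat => H.
  have [x0|/eqP/xs ->//] := eqVneq (x w) 0.
  by rewrite yt ?orbT // => y0; apply: H; rewrite x0 y0 mulr0 addr0.
move=> x y /asboolP[s xs] /asboolP[t yt]; apply/asboolP.
exists [seq u ++ v | u <- s, v <- t] => w; rewrite /GRing.mul /= conv_sum => H.
have [i xyi] : exists i : 'I_(size w).+1, x (take i w) * y (drop i w) <> 0.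
  apply: contrapT => nex; apply: H; rewrite big1 // => i _.
  by apply: contrapT => xyi; apply: nex; exists i.
apply/allpairsP; exists (take i w, drop i w); rewrite /= cat_take_drop; split=> //.
  by apply: xs => x0; apply: xyi; rewrite x0 mul0r.
by apply: yt => y0; apply: xyi; rewrite y0 mulr0.
Qed.

HB.instance Definition _ :=
  GRing.isSubalgClosed.Build K (F0 G K) finite_support finite_support_subalg.

Definition free := {x : F0 G K | x \in finite_support}.
HB.instance Definition _ := SubType.on free.
HB.instance Definition _ := [Choice of free by <:].
HB.instance Definition _ := [SubChoice_isSubAlgebra of free by <:].

Lemma fin_span x : x \in finite_support ->
  span (fun b => exists2 w, x w <> 0 & b = mon K w) x.
Proof.
move=> /asboolP[s0 xs0]; pose s := undup s0.
have xs w : x w <> 0 -> w \in s by rewrite mem_undup; apply: xs0.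
have {2}-> : x = \sum_(w <- s) x w *: mon K w.
  apply: funext => w; rewrite sum_coef.
  have [ws|ws] := boolP (w \in s).
    rewrite (bigD1_seq w) ?undup_uniq //= scaleFE monE eqxx mulr1 big1 ?addr0 //.
    by move=> u uw; rewrite scaleFE monE eq_sym (negPf uw) mulr0.
  have -> : x w = 0 by apply: contrapT => /xs; rewrite (negPf ws).
  rewrite big1_seq // => u /andP[_ us]; rewrite scaleFE monE.
  by case: eqP us => [<-|_ _]; rewrite ?(negPf ws) ?mulr0.
elim: s {xs} => [|w s IH]; first by rewrite big_nil; apply: span0.
rewrite big_cons; have [->|/eqP xw] := eqVneq (x w) 0.
  by rewrite scale0r add0r.
by apply: spanS => //; exists w.
Qed.

Lemma fsupp_mon w : w <> [::] -> fsupp (mon K w).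
Proof. by move=> /eqP w0; apply/fsuppP; rewrite monE eq_sym (negPf w0) mon_fin. Qed.

Lemma fsupp_fin x : fsupp x -> x \in finite_support.
Proof. by case/fsuppP. Qed.

Lemma fsupp0 : fsupp (0 : F0 G K).
Proof. by apply/fsuppP; rewrite rpred0. Qed.

Lemma fsuppD x y : fsupp x -> fsupp y -> fsupp (x + y).
Proof.
move=> /fsuppP[x0 xf] /fsuppP[y0 yf]; apply/fsuppP.
by rewrite addFE x0 y0 addr0 rpredD.
Qed.

Lemma fsuppZ k x : fsupp x -> fsupp (k *: x).
Proof. by move=> /fsuppP[x0 xf]; apply/fsuppP; rewrite scaleFE x0 mulr0 rpredZ. Qed.

Lemma mul_coef0 x y : (x * y) [::] = x [::] * y [::].
Proof. by []. Qed.

Lemma fsuppM x y : fsupp x -> fsupp y -> fsupp (x * y).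
Proof.
move=> /fsuppP[x0 xf] /fsuppP[y0 yf]; apply/fsuppP.
by rewrite mul_coef0 x0 mul0r rpredM.
Qed.

Lemma fsupp_mulF x y : fsupp x -> fsupp y -> mulF x y = x * y.
Proof. by move=> [x0 _] [y0 _]; apply: mulFE. Qed.

(** The constant term of [a] acts as a scalar, and the rest satisfies [fsupp]. *)
Lemma free_ideal_mul J a x : free_ideal J -> a \in finite_support -> J x ->
  J (a * x) /\ J (x * a).
Proof.
move=> [Jf [_ [JD [JZ JM]]]] af Jx.
have [b bf ->] : exists2 b, fsupp b & a = a [::] *: 1 + b.
  exists (a - a [::] *: 1); last by rewrite addrC subrK.
  apply/fsuppP; rewrite addFE oppFE scaleFE rpredB ?rpredZ ?rpred1 //.
  by rewrite -mon1 monE eqxx mulr1 subrr.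
have [bx xb] := JM _ _ bf Jx; have xf := Jf _ Jx.
rewrite fsupp_mulF // in bx; rewrite fsupp_mulF // in xb.
rewrite mulrDl mulrDr -scalerAl -scalerAr mul1r mulr1.
by split; apply: JD => //; apply: JZ.
Qed.

Lemma free_idealN J x : free_ideal J -> J x -> J (- x).
Proof. by move=> [_ [_ [_ [JZ _]]]] Jx; rewrite -scaleN1r; apply: JZ. Qed.

Lemma free_ideal_sum J (T : eqType) (s : seq T) (f : T -> F0 G K) : free_ideal J ->
  (forall i, i \in s -> J (f i)) -> J (\sum_(i <- s) f i).
Proof.
move=> [_ [J0 [JD _]]] Jf; rewrite big_seq.
by apply: (big_ind J) => //; apply: JD.
Qed.

Lemma L_ideal_free I : L_ideal I -> free_ideal I.
Proof. by move=> [If [_ [I0 [ID [IZ IM]]]]]. Qed.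

(** Members of [J] have constant coefficient 0, so even all of $L_K(G)$ is a proper ideal of the
    unital algebra. *)
Lemma free_ideal_one J : free_ideal J -> ~ J 1.
Proof.
by move=> [Jf _] /Jf[/eqP]; rewrite -mon1 monE eqxx oner_eq0.
Qed.

(** * Ideals generated by homogeneous elements *)

Section Generated.
Variable S : F0 G K -> Prop.
Hypothesis S_homog : forall g, S g -> exists n, homog n g.

(** For [S] the relations [lpa_rel] this is [Rel]. *)
Definition generated x := forall J, free_ideal J -> (forall g, S g -> J g) -> J x.

Lemma fsupp_ideal : free_ideal (@fsupp G K).
Proof.
split=> //; split; first exact: fsupp0.
split; first exact: fsuppD; split; first exact: fsuppZ.
by move=> a x af xf; rewrite !fsupp_mulF //; split; apply: fsuppM.
Qed.

Lemma generated_ideal : free_ideal generated.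
Proof.
split=> [x|]; first by apply; [exact: fsupp_ideal | move=> g /S_homog[n []]].
split=> [J [_ [J0 _]] _//|].
split=> [x y Sx Sy J Ji JS|].
  by have [_ [_ [JD _]]] := Ji; apply: JD; [apply: Sx | apply: Sy].
split=> [k x Sx J Ji JS|].
  by have [_ [_ [_ [JZ _]]]] := Ji; apply: JZ; apply: Sx.
move=> a x af Sx; split=> J Ji JS; have [_ [_ [_ [_ /(_ a x af)]]]] := Ji.
  by case; first exact: Sx.
by case; first exact: Sx.
Qed.

End Generated.

Lemma lpa_homog (g : F0 G K) : lpa_rel g -> exists n, homog n g.
Proof.
have hm w n : w <> [::] -> deg w = n -> @homog G K n (mon K w).
  move=> w0 wn; split=> [|u]; first exact: fsupp_mon.
  by rewrite monE; case: eqP => // ->.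
have hB x y n : homog n x -> homog n y -> homog n (subF x y).
  move=> [xf xn] [yf yn]; split.
    by rewrite subFE; apply: fsuppD => //; rewrite -scaleN1r; apply: fsuppZ.
  move=> w; rewrite /subF /addF /oppF => H; have [x0|/eqP/xn//] := eqVneq (x w) 0.
  by apply: yn => y0; apply: H; rewrite x0 y0 subrr.
case=> [v w _|v|e|e|e|e|e f _|e|v l _ _ _].
1: by exists 0; apply: hm => //=; rewrite ?addr0 ?subrr.
1: by exists 0; apply: hB; apply: hm => //=; rewrite ?addr0 ?subrr.
1,2: by exists 1; apply: hB; apply: hm => //=; rewrite ?addr0 ?add0r ?subrr.
1,2: by exists (-1); apply: hB; apply: hm => //=; rewrite ?addr0 ?add0r ?subrr.
1: by exists 0; apply: hm => //=; rewrite ?addr0 ?subrr.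
1: by exists 0; apply: hB; apply: hm => //=; rewrite ?addr0 ?subrr.
exists 0; apply: hB; first by apply: hm.
elim: l => [|e l [IHf IHn]] /=; first by split=> //; exact: fsupp0.
split=> [|w]; first by apply: fsuppD => //; apply: fsupp_mon.
rewrite /addF monE => H; have [->//|we] := eqVneq w [:: LE e; LG e].
by apply: IHn => s0; apply: H; rewrite s0 (negPf we) addr0.
Qed.

Lemma Rel_ideal : free_ideal (@Rel G K).
Proof. exact: (generated_ideal lpa_homog). Qed.

Lemma generated_L_ideal S : (forall g, S g -> exists n, homog n g) ->
  (forall g, lpa_rel g -> S g) -> L_ideal (generated S).
Proof.
move=> Sh relS; have [Sf [S0 [SD [SZ SM]]]] := generated_ideal Sh.
split=> //; split=> [x y Sx yf xy|//].
have -> : y = x + - (x - y) by rewrite opprB addrC subrK.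
apply: SD => //; apply: (free_idealN (generated_ideal Sh)) => J Ji JS.
by apply: xy => // g /relS /JS.
Qed.

Lemma L_ideal_Rel I x : L_ideal I -> Rel x -> I x.
Proof.
move=> [_ [IL [I0 _]]] Rx; have [Rf _] := Rel_ideal.
apply: IL I0 (Rf _ Rx) _; rewrite /Leq subFE sub0r.
exact: free_idealN Rel_ideal Rx.
Qed.

Lemma Rel_L_ideal : L_ideal (@Rel G K).
Proof. exact: (generated_L_ideal lpa_homog). Qed.

(** * Quotients of the Leavitt path algebra *)

Section Quotient.
Variable I : F0 G K -> Prop.
Hypothesis L_I : L_ideal I.

Let mem (x : free) := I (val x).
Let mem0 : mem 0. Proof. by case: L_I => _ [_ []]. Qed.
Let memD (x y : free) : mem x -> mem y -> mem (x + y).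
Proof. by case: L_I => _ [_ [_ [ID _]]]; apply: ID. Qed.
Let memMl (a x : free) : mem x -> mem (a * x).
Proof. by move=> Ix; case: (free_ideal_mul (L_ideal_free L_I) (valP a) Ix). Qed.
Let memMr (a x : free) : mem x -> mem (x * a).
Proof. by move=> Ix; case: (free_ideal_mul (L_ideal_free L_I) (valP a) Ix). Qed.
Let mem1 : ~ mem 1.
Proof. exact: free_ideal_one (L_ideal_free L_I). Qed.

Definition lpa_ideal : ideal free := Ideal mem0 memD memMl memMr mem1.

Definition fmon w : free := Sub (mon K w) (mon_fin w).
Local Notation Q := (quot lpa_ideal).
Local Notation pi := (cls lpa_ideal).
Definition qV v : Q := pi (fmon [:: LV v]).
Definition qE e : Q := pi (fmon [:: LE e]).
Definition qEs e : Q := pi (fmon [:: LG e]).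

Lemma piM (x y : free) : pi (x * y) = pi x * pi y.
Proof. exact: rmorphM. Qed.

Lemma fmonM u w : fmon u * fmon w = fmon (u ++ w).
Proof. by apply: val_inj; rewrite /= mul_mon. Qed.

Lemma pi_rel (x : free) : lpa_rel (val x) -> pi x = 0.
Proof. by move=> xr; apply/cls_eq0/(L_ideal_Rel L_I) => J _; apply. Qed.

Lemma pi_rel_eq (x y : free) : lpa_rel (subF (val x) (val y)) -> pi x = pi y.
Proof.
move=> xy; apply/eqP; rewrite -subr_eq0 -rmorphB; apply/eqP/pi_rel.
by rewrite rmorphB.
Qed.

Lemma quot_leavitt : leavitt_family qV qE qEs.
Proof.
split; rewrite /qV /qE /qEs; try by
  move=> *; rewrite -rmorphM fmonM; apply: pi_rel_eq; constructor.
- by move=> v w vw; rewrite -rmorphM fmonM; apply: pi_rel; constructor.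
- by move=> e f ef; rewrite -rmorphM fmonM; apply: pi_rel; constructor.
- move=> v l l0 ul lv.
  transitivity (pi (\sum_(e <- l) fmon [:: LE e; LG e])); last first.
    by rewrite rmorph_sum; apply: eq_bigr => e _; rewrite -rmorphM fmonM.
  apply: pi_rel_eq.
  have -> : val (\sum_(e <- l) fmon [:: LE e; LG e])
      = sumF (map (fun e => mon K [:: LE e; LG e]) l).
    by rewrite sumFE big_map rmorph_sum.
  apply: rel_ck2 => //; first exact/NoDup_uniq.
  by move=> e; split=> [/In_mem/lv//|/lv/In_mem].
Qed.

Lemma pi_fmon w : pi (fmon w) = word_val qV qE qEs w.
Proof.
rewrite /word_val; elim: w => [|l w IH].
  by rewrite big_nil -(rmorph1 pi); congr pi; apply: val_inj.
rewrite big_cons -IH -[l :: w]/([:: l] ++ w) -fmonM rmorphM; congr (_ * _).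
by case: l.
Qed.

(** Only words in the support of [x] occur, so their degrees are known when [x] is homogeneous. *)
Lemma free_span (x : free) :
  span (fun b => exists2 w, val x w <> 0 & b = word_val qV qE qEs w) (pi x).
Proof.
suff H (y : F0 G K) : span (fun b => exists2 w, val x w <> 0 & b = mon K w) y ->
    forall z : free, val z = y ->
    span (fun b => exists2 w, val x w <> 0 & b = word_val qV qE qEs w) (pi z).
  by apply: (H _ (fin_span (valP x))).
elim=> [|k b {}y [w xw ->] _ IH] z zy.
  have -> : z = 0 by apply: val_inj; rewrite zy.
  by rewrite rmorph0; apply: span0.
have -> : z = k *: fmon w + (z - k *: fmon w) by rewrite addrC subrK.
rewrite linearP /=; apply: spanS; first by exists w; rewrite // pi_fmon.
have vw : val (k *: fmon w) = k *: mon K w by [].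
by apply: IH; rewrite rmorphB [X in X - _]zy [X in _ - X]vw addrAC subrr add0r.
Qed.

Lemma span_all (q : Q) : span (fun b => exists w, b = word_val qV qE qEs w) q.
Proof.
have [x ->] := cls_surj q; apply: span_sub (free_span x) => b [w _ ->].
by exists w.
Qed.

Lemma qV_eq0 v : qV v = 0 <-> I (mon K [:: LV v]).
Proof. by rewrite /qV cls_eq0. Qed.

Lemma L_hereditary : hereditary (fun v => I (mon K [:: LV v])).
Proof. by move=> e /qV_eq0 /(V_hereditary quot_leavitt) /qV_eq0. Qed.

Lemma L_saturated : saturated (fun v => I (mon K [:: LV v])).
Proof.
move=> v l [l0 ul lv] rv; apply/qV_eq0; apply: (V_saturated quot_leavitt l0 ul lv).
by move=> e /rv /qV_eq0.
Qed.

Lemma L_reduction n x :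
  (forall (w : vert G) (l : seq (edge G)),
     ~ I (mon K [:: LV w]) -> infinite_emitter w ->
     exists e, [/\ src e = w, e \notin l & ~ I (mon K [:: LV (rng e)])]) ->
  homog n x -> ~ I x ->
  exists a b v, [/\ a \in finite_support, b \in finite_support,
    ~ I (mon K [:: LV v]) & I (a * x * b - mon K [:: LV v])].
Proof.
move=> ie [xf xn] nIx; have /asboolP[s xs] := fsupp_fin xf.
pose X : free := Sub x (fsupp_fin xf).
(* The longest word bounds the number of ghost edges. *)
have sX : span (hmono qV qE qEs n (\max_(w <- s) size w)) (pi X).
  apply: (span_linear (f := id)) (free_span X) => // b [w /= xw ->].
  have w0 : w <> [::] by move=> w0; case: xw; rewrite w0; case: (xf).
  have [->|] := word_val_mono quot_leavitt w0; first exact: span0.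
  move=> wm; apply: span_gen; rewrite -(xn w xw); apply: hmono_widen wm.
  by apply: leq_bigmax_seq => //; apply: xs.
have [||a [b [v [Vv avb]]]] := homogeneous_reduction quot_leavitt _ sX.
- move=> w l Vw iew; have [|e [ew el re]] := ie w l _ iew; first by move/qV_eq0.
  by exists e; split=> // /qV_eq0.
- by move/cls_eq0.
have [A aA] := cls_surj a; have [B bB] := cls_surj b.
exists (val A), (val B), v; split; [exact: valP|exact: valP|by move/qV_eq0|].
have : pi (A * X * B) = pi (fmon [:: LV v]) by rewrite !piM -aA -bB avb.
by move/clsP.
Qed.

(** Modulo [I], $u=uu=(uav)b$, so $uav$ is nonzero. *)
Lemma L_common_descendant u v a b : a \in finite_support -> b \in finite_support ->
  I (a * mon K [:: LV v] * b - mon K [:: LV u]) -> ~ I (mon K [:: LV u]) ->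
  exists2 t, reach u t & reach v t.
Proof.
move=> af bf; pose A : free := Sub a af; pose B : free := Sub b bf.
move=> Iab nIu; have : pi (A * fmon [:: LV v] * B) = qV u by apply/clsP.
rewrite !piM -/(qV v) => E1.
apply: (common_descendant quot_leavitt (span_all (pi A))) => E2.
apply/nIu/qV_eq0; rewrite -(lf_VV quot_leavitt) -{2}E1 !mulrA E2 mul0r //.
Qed.

End Quotient.

(** * Homogeneous components *)

Definition hcomp (n : int) x : F0 G K := fun w => if deg w == n then x w else 0.

Lemma hcompP n : linear (hcomp n).
Proof.
move=> k x y; apply: funext => w; rewrite addFE scaleFE /hcomp.
by case: eqP; rewrite ?mulr0 ?addr0.
Qed.

Lemma hcomp0 n : hcomp n 0 = 0.
Proof. exact: linear_at0 (@hcompP n). Qed.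

Lemma hcomp_sum n (T : Type) (s : seq T) (f : T -> F0 G K) :
  hcomp n (\sum_(i <- s) f i) = \sum_(i <- s) hcomp n (f i).
Proof.
elim: s => [|i s IH]; first by rewrite !big_nil hcomp0.
by rewrite !big_cons -IH -[f i]scale1r hcompP !scale1r.
Qed.

Lemma fsupp_hcomp n x : fsupp x -> fsupp (hcomp n x).
Proof.
move=> [x0 [s xs]]; split; first by rewrite /hcomp x0 if_same.
by exists s => w; rewrite /hcomp; case: eqP => // _ /xs.
Qed.

Lemma homog_hcomp n x : fsupp x -> homog n (hcomp n x).
Proof.
by split=> [|w]; [exact: fsupp_hcomp | rewrite /hcomp; case: eqP].
Qed.

Lemma hcomp_homog n m x : homog m x -> hcomp n x = if n == m then x else 0.
Proof.
move=> [_ xm]; apply: funext => w; rewrite /hcomp.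
have [x0|/eqP xw] := eqVneq (x w) 0; first by rewrite x0 if_same; case: ifP.
by rewrite -(xm w xw) eq_sym; case: eqP.
Qed.

Lemma hcomp_total x : fsupp x -> exists s : seq int, x = \sum_(n <- s) hcomp n x.
Proof.
move=> [_ [s xs]]; exists (undup (map (@deg G) s)).
apply: funext => w; rewrite sum_coef.
have [x0|/eqP xw] := eqVneq (x w) 0.
  by rewrite x0 big1 // => n _; rewrite /hcomp; case: eqP => //; rewrite x0.
rewrite (bigD1_seq (deg w)) ?undup_uniq //=; last first.
  by rewrite mem_undup; apply/map_f/In_mem/xs.
rewrite {1}/hcomp eqxx big1 ?addr0 // => n nw.
by rewrite /hcomp eq_sym (negPf nw).
Qed.

Lemma deg_cat (u w : word G) : deg (u ++ w) = deg u + deg w.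
Proof. by elim: u => [|l u IH] /=; rewrite ?add0r // IH addrA. Qed.

Lemma hcomp_mull n m x y : homog m y -> hcomp (n + m) (x * y) = hcomp n x * y.
Proof.
move=> [_ ym]; apply: funext => w; rewrite /hcomp /GRing.mul /= !conv_sum.
case: eqP => wn.
  apply: eq_bigr => i _; have [->|/eqP yi] := eqVneq (y (drop i w)) 0.
    by rewrite !mulr0.
  move: wn; rewrite -{1}(cat_take_drop i w) deg_cat (ym _ yi).
  by move/addIr => ->; rewrite eqxx.
rewrite big1 // => i _; have [->|/eqP yi] := eqVneq (y (drop i w)) 0.
  by rewrite mulr0.
case: eqP; last by rewrite mul0r.
by move=> tn; case: wn; rewrite -(cat_take_drop i w) deg_cat (ym _ yi) tn.
Qed.

Lemma hcomp_mulr n m x y : homog m x -> hcomp (m + n) (x * y) = x * hcomp n y.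
Proof.
move=> [_ xm]; apply: funext => w; rewrite /hcomp /GRing.mul /= !conv_sum.
case: eqP => wn.
  apply: eq_bigr => i _; have [->|/eqP xi] := eqVneq (x (take i w)) 0.
    by rewrite !mul0r.
  move: wn; rewrite -{1}(cat_take_drop i w) deg_cat (xm _ xi).
  by move/addrI => ->; rewrite eqxx.
rewrite big1 // => i _; have [->|/eqP xi] := eqVneq (x (take i w)) 0.
  by rewrite mul0r.
case: eqP; last by rewrite mulr0.
by move=> tn; case: wn; rewrite -(cat_take_drop i w) deg_cat (xm _ xi) tn.
Qed.

Definition hclosed I := forall n x, I x -> I (hcomp n x).

(** The elements whose components all lie in [generated S] form an ideal containing [S]; products
    need checking only with words, which shift degrees. *)
Lemma generated_hclosed S : (forall g, S g -> exists n, homog n g) ->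
  hclosed (generated S).
Proof.
move=> Sh n x; have Sid := generated_ideal Sh; have [Sf [S0 [SD [SZ _]]]] := Sid.
move=> Sx; pose J y := fsupp y /\ forall m, generated S (hcomp m y).
suff JI : free_ideal J.
  have [|_ SJ] := Sx J JI _; last exact: SJ.
  move=> g Sg; have [m gm] := Sh g Sg; split=> [|d]; first by case: gm.
  by rewrite (hcomp_homog d gm); case: ifP => // _ I _; apply.
clear x n Sx; rewrite /J.
split=> [x []//|]; split; first by split=> [|n]; rewrite ?hcomp0 //; exact: fsupp0.
split.
  move=> x y [xf xS] [yf yS]; split=> [|n]; first exact: fsuppD.
  by rewrite -[addF x y]/(x + y) -[x]scale1r hcompP scale1r; apply: SD.
split.
  move=> k x [xf xS]; split=> [|n]; first exact: fsuppZ.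
  by rewrite -[scaleF k x]addr0 hcompP hcomp0 addr0; apply: SZ.
move=> a x af [xf xS]; rewrite !fsupp_mulF //.
split; (split=> [|n]; first exact: fsuppM);
  elim: (fin_span (fsupp_fin af)) n => [|k b y [w aw ->] _ IH] n.
- by rewrite mul0r hcomp0.
- rewrite mulrDl -scalerAl hcompP; apply: SD; last exact: IH.
  have mw : homog (deg w) (mon K w).
    split=> [|u]; last by rewrite monE; case: eqP => // ->.
    by apply: fsupp_mon => w0; case: aw; rewrite w0; case: af.
  apply: SZ; rewrite -(addrNK (deg w) n) addrC (hcomp_mulr _ _ mw).
  by case: (free_ideal_mul Sid (mon_fin w) (xS (n - deg w))).
- by rewrite mulr0 hcomp0.
- rewrite mulrDr -scalerAr hcompP; apply: SD; last exact: IH.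
  have mw : homog (deg w) (mon K w).
    split=> [|u]; last by rewrite monE; case: eqP => // ->.
    by apply: fsupp_mon => w0; case: aw; rewrite w0; case: af.
  apply: SZ; rewrite -(addrNK (deg w) n) (hcomp_mull _ _ mw).
  by case: (free_ideal_mul Sid (mon_fin w) (xS (n - deg w))).
Qed.

Lemma Rel_hclosed : hclosed (@Rel G K).
Proof. exact: (generated_hclosed lpa_homog). Qed.

(** Components in the free algebra descend to $L_K(G)$ because [Rel] is closed under them. *)
Lemma gradedP I : L_ideal I -> (graded I <-> hclosed I).
Proof.
move=> LI; have [If [IL _]] := LI; have Ii := L_ideal_free LI; split.
  move=> gI n x Ix; have [s [sI xs]] := gI x Ix.
  apply: (IL (hcomp n (sumF (map snd s)))); last first.
  - rewrite /Leq subFE; have := Rel_hclosed n (free_idealN Rel_ideal xs).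
    by rewrite subFE opprB -{1}[sumF _]scale1r -[x in _ - x]scale1r -scaleNr addrC
         hcompP scaleN1r scale1r addrC.
  - by apply: fsupp_hcomp; apply: If.
  rewrite sumFE big_map hcomp_sum big_seq.
  have [_ [I0 [ID _]]] := Ii; apply: (big_ind I) => // p ps.
  have [Ip hp] := sI p ((In_mem p s).2 ps); rewrite (hcomp_homog n hp).
  by case: eqP.
move=> hI x Ix; have [s xs] := hcomp_total (If _ Ix).
exists [seq (n, hcomp n x) | n <- s]; split.
  move=> p /In_mem/mapP[n _ ->]; split; first exact: hI.
  exact/homog_hcomp/If.
rewrite -map_comp sumFE big_map /= -xs /Leq subFE subrr.
by have [_ [R0 _]] := Rel_ideal.
Qed.

(** * Annihilators of graded ideals *)

Lemma annE I r : L_ideal I -> ann I r <->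
  fsupp r /\ forall x, I x -> Rel (r * x) /\ Rel (x * r).
Proof.
by move=> [If _]; split=> -[rf rI]; split=> // x Ix; move: (rI x Ix);
   rewrite !fsupp_mulF //; apply: If.
Qed.

Lemma ann_L_ideal I : L_ideal I -> L_ideal (ann I).
Proof.
move=> LI; have [If _] := LI; have Ri := Rel_ideal; have [_ [R0 [RD [RZ _]]]] := Ri.
split=> [x []//|]; split.
  move=> x y /(annE _ LI)[xf xI] yf xy; apply/(annE _ LI); split=> // z Iz.
  have [xz zx] := xI z Iz; have zf := fsupp_fin (If _ Iz).
  have -> : y = x + - (x - y) by rewrite opprB addrC subrK.
  have [d1 d2] := free_ideal_mul Ri zf (free_idealN Ri xy).
  by rewrite mulrDl mulrDr; split; apply: RD.
split.
  apply/(annE _ LI); split=> [|z _]; first exact: fsupp0.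
  by rewrite mul0r mulr0.
split.
  move=> x y /(annE _ LI)[xf xI] /(annE _ LI)[yf yI]; apply/(annE _ LI).
  split=> [|z Iz]; first exact: fsuppD.
  have [? ?] := xI z Iz; have [? ?] := yI z Iz.
  by rewrite -[addF x y]/(x + y) mulrDl mulrDr; split; apply: RD.
split.
  move=> k x /(annE _ LI)[xf xI]; apply/(annE _ LI).
  split=> [|z Iz]; first exact: fsuppZ.
  have [? ?] := xI z Iz.
  by rewrite -[scaleF k x]/(k *: x) -scalerAl -scalerAr; split; apply: RZ.
move=> a x af /(annE _ LI)[xf xI]; rewrite !fsupp_mulF //.
have Ii := L_ideal_free LI; have af' := fsupp_fin af.
split; apply/(annE _ LI); (split=> [|z Iz]; first exact: fsuppM).
  have [xz _] := xI z Iz; have [_ /xI[_ zax]] := free_ideal_mul Ii af' Iz.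
  rewrite -mulrA [z * (a * x)]mulrA; split=> //.
  by case: (free_ideal_mul Ri af' xz).
have [_ zx] := xI z Iz; have [/xI[xaz _] _] := free_ideal_mul Ii af' Iz.
rewrite -mulrA [z * (x * a)]mulrA; split=> //.
by case: (free_ideal_mul Ri af' zx).
Qed.

(** If $y_d$ is a component of [y], it lies in [I], and $r_ny_d$ is a component of $ry_d$; likewise
    on the other side. *)
Lemma ann_hclosed I : L_ideal I -> hclosed I -> hclosed (ann I).
Proof.
move=> LI hI n r /(annE _ LI)[rf rI]; have [If _] := LI.
apply/(annE _ LI); split=> [|y Iy]; first exact: fsupp_hcomp.
have [s ys] := hcomp_total (If _ Iy).
split; rewrite ys ?mulr_sumr ?mulr_suml; apply: (free_ideal_sum Rel_ideal) => d _.
  rewrite -(hcomp_mull n r (homog_hcomp d (If _ Iy))); apply: Rel_hclosed.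
  by case: (rI _ (hI d _ Iy)).
rewrite -(hcomp_mulr n r (homog_hcomp d (If _ Iy))); apply: Rel_hclosed.
by case: (rI _ (hI d _ Iy)).
Qed.

End FreeAlgebra.

(** * The boundary path representation *)

Section Evaluation.
Variables (G : graph) (K : fieldType).
Implicit Types (x y : F0 G K) (w : word G) (k : K) (f : word G -> K).

Definition covers (s : seq (word G)) x := uniq s /\ forall w, x w <> 0 -> w \in s.

Definition supp x : seq (word G) :=
  if pselect (exists s, covers s x) is left e then projT1 (cid e) else [::].

(** The linear extension of [f] from words to finitely supported series. *)
Definition ev f x : K := \sum_(w <- supp x) x w * f w.

Lemma ev_covers f x s : covers s x -> ev f x = \sum_(w <- s) x w * f w.
Proof.
have sum_filter t : \sum_(w <- t) x w * f w = \sum_(w <- t | x w != 0) x w * f w.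
  rewrite [RHS]big_mkcond; apply: eq_bigr => w _.
  by case: eqVneq => [->|//]; rewrite mul0r.
move=> [us xs]; rewrite /ev /supp; case: pselect => [e|]; last by case; exists s.
case: (cid e) => t [ut xt] /=; rewrite [LHS]sum_filter [RHS]sum_filter.
rewrite -[LHS]big_filter -[RHS]big_filter.
apply/perm_big/uniq_perm; rewrite ?filter_uniq // => w; rewrite !mem_filter.
by case: eqP => //= xw; rewrite xs ?xt.
Qed.

Lemma fin_covers x : x \in @finite_support G K -> exists s, covers s x.
Proof.
move=> /asboolP[s xs]; exists (undup s); split=> [|w]; first exact: undup_uniq.
by rewrite mem_undup; apply: xs.
Qed.

Lemma ev_linear f k x y : x \in @finite_support G K -> y \in @finite_support G K ->
  ev f (k *: x + y) = k * ev f x + ev f y.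
Proof.
move=> /fin_covers[s [_ xs]] /fin_covers[t [_ yt]]; pose r := undup (s ++ t).
have ur : uniq r by apply: undup_uniq.
have xr : covers r x by split=> // w /xs; rewrite mem_undup mem_cat => ->.
have yr : covers r y by split=> // w /yt; rewrite mem_undup mem_cat orbC => ->.
have xyr : covers r (k *: x + y).
  split=> // w; rewrite addFE scaleFE => H; have [x0|/eqP/xr.2//] := eqVneq (x w) 0.
  by apply: yr.2 => y0; apply: H; rewrite x0 y0 mulr0 addr0.
rewrite (ev_covers f xr) (ev_covers f yr) (ev_covers f xyr) mulr_sumr -big_split.
by apply: eq_bigr => w _; rewrite /= addFE scaleFE mulrDl mulrA.
Qed.

Lemma ev_mon f w : ev f (mon K w) = f w.
Proof.
rewrite (@ev_covers f _ [:: w]); first by rewrite big_seq1 monE eqxx mul1r.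
by split=> // u; rewrite monE inE; case: eqP.
Qed.

Lemma ev0 f : ev f 0 = 0.
Proof. by rewrite (@ev_covers f _ [::]) ?big_nil //; split. Qed.

Lemma fin_ind (P : F0 G K -> Prop) : P 0 ->
  (forall k w y, y \in @finite_support G K -> P y -> P (k *: mon K w + y)) ->
  forall x, x \in @finite_support G K -> P x.
Proof.
move=> P0 PS x /fin_span sx.
suff [] : x \in @finite_support G K /\ P x by [].
elim: sx => [|k b y [w _ ->] _ [yf Py]]; first by rewrite rpred0.
by split; [rewrite rpredD ?rpredZ ?mon_fin | apply: PS].
Qed.

Lemma ev_mull f u x : x \in @finite_support G K ->
  ev f (mon K u * x) = ev (fun w => f (u ++ w)) x.
Proof.
move: x; apply: fin_ind => [|k w y yf IH]; first by rewrite mulr0 !ev0.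
rewrite mulrDr -scalerAr mul_mon !ev_linear ?mon_fin ?rpredM ?mon_fin //.
by rewrite !ev_mon IH.
Qed.

Lemma ev_mulr f u x : x \in @finite_support G K ->
  ev f (x * mon K u) = ev (fun w => f (w ++ u)) x.
Proof.
move: x; apply: fin_ind => [|k w y yf IH]; first by rewrite mul0r !ev0.
rewrite mulrDl -scalerAl mul_mon !ev_linear ?mon_fin ?rpredM ?mon_fin //.
by rewrite !ev_mon IH.
Qed.

End Evaluation.

(* The letters act by partial injections on the boundary paths avoiding [H]:
   a boundary path lists the vertices it visits, each with the edge by which it
   leaves (or [None] once it stops, after which the entries are irrelevant). *)
Section BoundaryPaths.
Variables (G : graph) (K : fieldType) (H : vert G -> Prop).
Hypotheses (H_hered : hereditary H) (H_sat : saturated H).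

Definition bpath := nat -> vert G * option (edge G).
Implicit Types (xi : bpath) (g : bpath -> K).

(** A path may stop only at a sink or at an infinite emitter. *)
Definition boundary xi := forall n, ~ H (xi n).1 /\
  match (xi n).2 with
  | Some e => src e = (xi n).1 /\ (xi n.+1).1 = rng e
  | None => forall l, ~ regular (xi n).1 l
  end.

Definition bcons e xi : bpath :=
  fun n => if n is m.+1 then xi m else (src e, Some e).
Definition btail xi : bpath := fun n => xi n.+1.

(** A right action: an edge removes itself from the front of a path, and its ghost prepends it. *)
Definition act (l : letter G) xi : option bpath :=
  match l with
  | LV v => if (xi 0).1 == v then Some xi else None
  | LE e => if (xi 0).2 == Some e then Some (btail xi) else None
  | LG e => if (xi 0).1 == rng e then Some (bcons e xi) else None
  end.

Fixpoint act_word (w : word G) xi : option bpath :=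
  if w is l :: w' then obind (act_word w') (act l xi) else Some xi.

Lemma act_word_cat u w xi :
  act_word (u ++ w) xi = obind (act_word w) (act_word u xi).
Proof. by elim: u xi => [//|l u IH] xi /=; case: act. Qed.

Lemma act_boundary l xi xi' : boundary xi -> act l xi = Some xi' -> boundary xi'.
Proof.
move=> bxi; case: l => [v|e|e] /=; case: eqP => // E1 [<-] //.
- by move=> n; apply: bxi.
case=> [|n] /=; last exact: bxi.
by split=> // /H_hered; rewrite -E1; have [] := bxi 0.
Qed.

Lemma act_word_boundary w xi xi' :
  boundary xi -> act_word w xi = Some xi' -> boundary xi'.
Proof.
elim: w xi => [|l w IH] xi bxi /=; first by case=> <-.
by case E1: act => [xi''|] //=; apply: IH; apply: act_boundary bxi E1.
Qed.

Definition word_fun g xi (w : word G) : K := oapp g 0 (act_word w xi).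

(** The elements acting as 0 on all functions [g] on boundary paths. *)
Definition act_kernel (x : F0 G K) :=
  fsupp x /\ forall g xi, boundary xi -> ev (word_fun g xi) x = 0.

(** A word multiplied on the left moves [xi]; one multiplied on the right replaces [g] by its
    pullback. *)
Lemma act_kernel_ideal : free_ideal act_kernel.
Proof.
have lin k (x y : F0 G K) : act_kernel x -> act_kernel y -> act_kernel (k *: x + y).
  move=> [xf x0] [yf y0]; split=> [|g xi bxi].
    by apply: fsuppD => //; apply: fsuppZ.
  by rewrite ev_linear ?fsupp_fin // x0 ?y0 // mulr0 addr0.
have ker0 : act_kernel 0 by split=> [|g xi _]; [exact: fsupp0 | exact: ev0].
split=> [x []//|]; split=> //.
split=> [x y xk yk|]; first by rewrite -[addF x y]/(x + y) -[x]scale1r; apply: lin.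
split=> [k x xk|]; first by rewrite -[scaleF k x]addr0; apply: lin.
move=> a x af [xf x0]; rewrite !fsupp_mulF //.
have xfin := fsupp_fin xf; have afin := fsupp_fin af.
split; split; try exact: fsuppM; move=> g xi bxi; move: a afin {af};
  apply: fin_ind => [|k u y yf IH].
- by rewrite mul0r ev0.
- rewrite mulrDl -scalerAl ev_linear ?rpredM ?mon_fin // IH addr0 ev_mull //.
  rewrite (_ : (fun w => _) =
      if act_word u xi is Some xi' then word_fun g xi' else fun=> 0).
    case E1: act_word => [xi'|].
      by rewrite x0 ?mulr0 //; apply: act_word_boundary E1.
    have [s xs] := fin_covers xfin.
    by rewrite (ev_covers _ xs) big1 ?mulr0 // => w _; rewrite mulr0.
  by apply: funext => w; rewrite /word_fun act_word_cat; case: act_word.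
- by rewrite mulr0 ev0.
- rewrite mulrDr -scalerAr ev_linear ?rpredM ?mon_fin // IH addr0 ev_mulr //.
  rewrite (_ : (fun w => _) = word_fun (fun xi' => oapp g 0 (act_word u xi')) xi).
    by rewrite x0 // mulr0.
  by apply: funext => w; rewrite /word_fun act_word_cat; case: act_word.
Qed.

Lemma act_kernel_lpa x : lpa_rel x -> act_kernel x.
Proof.
move=> xr; split=> [|g xi bxi]; first by have [n []] := lpa_homog xr.
have evB u w : word_fun g xi u = word_fun g xi w ->
    ev (word_fun g xi) (subF (mon K u) (mon K w)) = 0.
  move=> E1; rewrite subFE addrC -scaleN1r ev_linear ?mon_fin // !ev_mon E1.
  by rewrite mulN1r addNr.
have [nH next] := bxi 0.
case: xr => [v w vw|v|e|e|e|e|e f ef|e|v l l0 /NoDup_uniq ul lv].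
- by rewrite ev_mon /word_fun /=; case: eqP => //= ->; case: eqP.
- by apply: evB; rewrite /word_fun /=; case: eqP => //= ->; rewrite eqxx.
- apply: evB; rewrite /word_fun /=; case: (eqVneq (xi 0).2 (Some e)) next => [E1|ne].
    by rewrite E1 => -[-> _]; rewrite eqxx /= E1 eqxx.
  by case: eqP => //= _ _; rewrite (negPf ne).
- apply: evB; rewrite /word_fun /=; case: (eqVneq (xi 0).2 (Some e)) next => [->|//].
  by move=> [_ nx] /=; rewrite /btail nx eqxx.
- by apply: evB; rewrite /word_fun /=; case: eqP => //= ->; rewrite eqxx.
- by apply: evB; rewrite /word_fun /=; case: eqP => //= _; rewrite eqxx.
- rewrite ev_mon /word_fun /=; case: eqP => //= _.
  by case: eqP => // -[] /ef.
- by apply: evB; rewrite /word_fun /=; case: eqP => //= _; rewrite eqxx.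
have evS (s : seq (edge G)) :
    ev (word_fun g xi) (\sum_(e <- s) mon K [:: LE e; LG e])
    = \sum_(e <- s) word_fun g xi [:: LE e; LG e].
  elim: s => [|e s IH]; first by rewrite !big_nil ev0.
  rewrite !big_cons -IH -[mon K _]scale1r ev_linear ?mon_fin ?ev_mon ?mul1r //.
  by apply: rpred_sum => i _; apply: mon_fin.
rewrite subFE sumFE big_map addrC -scaleN1r ev_linear ?mon_fin //; last first.
  by apply: rpred_sum => i _; apply: mon_fin.
rewrite evS ev_mon mulN1r addrC; apply/eqP; rewrite subr_eq0; apply/eqP.
have lreg : regular v l by split=> // e; split=> [/In_mem/lv//|/lv/In_mem].
rewrite {1}/word_fun /=; case: eqP => [xv|xv] /=; last first.
  rewrite big1_seq // => e /andP[_ /In_mem/lv ev]; rewrite /word_fun /=.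
  case: eqP next => //= -> [ex _]; by case: xv; rewrite -ex.
(* CK2 holds because a path at a regular vertex cannot stop: it leaves by exactly one edge of [l],
   whose term restores it. *)
case Ex: (xi 0).2 next => [e|]; last by rewrite xv => /(_ _ lreg).
move=> [ex nx]; have el : e \in l by apply/In_mem/lv; rewrite ex.
rewrite (bigD1_seq e) //= big1 ?addr0 => [|f /negPf fe].
  rewrite /word_fun /= Ex eqxx /= /btail nx eqxx /=; congr (g _).
  apply: funext => -[|n] //=.
  by rewrite ex -Ex; case: (xi 0).
by rewrite /word_fun /= Ex /eq_op /= eq_sym fe.
Qed.

(** By saturation a regular vertex outside [H] has an edge avoiding [H]. A stopped path repeats its
    last vertex. *)
Lemma boundary_from v : ~ H v -> exists2 xi, boundary xi & (xi 0).1 = v.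
Proof.
move=> nHv.
pose good u (o : option (edge G)) := match o with
  | Some e => src e = u /\ ~ H (rng e)
  | None => forall l, ~ regular u l end.
have /choice[o oP] : forall u, exists o, ~ H u -> good u o.
  move=> u; have [[l ul]|nr] := pselect (exists l, regular u l); last first.
    by exists None => _ l ul; apply: nr; exists l.
  have [[e eu re]|ne] := pselect (exists2 e, src e = u & ~ H (rng e)).
    by exists (Some e).
  exists None => nHu; case: nHu; apply: (H_sat ul) => e eu.
  by apply: contrapT => re; apply: ne; exists e.
pose nx u := if o u is Some e then rng e else u.
exists (fun n => let u := iter n nx v in (u, o u)) => // n /=.
have nHn : ~ H (iter n nx v).
  elim: n => [//|n IH]; rewrite iterS /nx.
  by have := oP _ IH; rewrite /good; case: (o _) => // e [].
split=> //; have := oP _ nHn; rewrite /good /nx.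
by case: (o _) => // e [].
Qed.

Definition lpa_rel_mod (x : F0 G K) :=
  lpa_rel x \/ exists2 h, H h & x = mon K [:: LV h].

Lemma lpa_rel_mod_homog x : lpa_rel_mod x -> exists n, homog n x.
Proof.
case=> [/lpa_homog//|[h _ ->]]; exists 0; split=> [|u]; first exact: fsupp_mon.
by rewrite monE; case: eqP => // -> _ /=; rewrite addr0.
Qed.

(** Vertices of [H] act as 0, while [v] fixes a boundary path starting at [v], as the constant
    function 1 detects. *)
Lemma vertex_not_generated v : ~ H v -> ~ generated lpa_rel_mod (mon K [:: LV v]).
Proof.
move=> /boundary_from[xi bxi xv] /(_ _ act_kernel_ideal)[|_ /(_ (fun=> 1) _ bxi)].
  move=> x [/act_kernel_lpa//|[h Hh ->]].
  split=> [|g xi' bxi']; first exact: fsupp_mon.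
  rewrite ev_mon /word_fun /=; case: eqP => // xh.
  by have [] := bxi' 0; rewrite xh.
by rewrite ev_mon /word_fun /= xv eqxx /= => /eqP; rewrite oner_eq0.
Qed.

End BoundaryPaths.

(** * Annihilator ideals *)

Section Main.
Variables (G : graph) (K : fieldType).
Implicit Types (x y r : F0 G K) (I J : F0 G K -> Prop) (u v t d h : vert G).
Local Notation vmon v := (mon K [:: LV v]).

(** The case of empty [H], which is saturated since a regular vertex emits an edge. *)
Lemma vertex_neq0 v : ~ Rel (vmon v).
Proof.
move=> Rv; apply: (@vertex_not_generated G K (fun=> False) _ _ v) => //.
  move=> w l [l0 ul lw] /=; case: l l0 {ul} lw => [//|e l] _ lw.
  by apply; apply/lw/mem_head.
by move=> J Ji JS; apply: Rv => // g gr; apply: JS; left.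
Qed.

Lemma hcomp_notin J x : free_ideal J -> fsupp x -> ~ J x -> exists n, ~ J (hcomp n x).
Proof.
move=> Ji xf nJx; apply: contrapT => H; apply: nJx.
have [s ->] := hcomp_total xf; apply: free_ideal_sum => // n _.
by apply: contrapT => nJn; apply: H; exists n.
Qed.

Lemma ideal_vertex J a y b v : L_ideal J -> a \in @finite_support G K ->
  b \in @finite_support G K -> J y -> J (a * y * b - vmon v) -> J (vmon v).
Proof.
move=> LJ af bf Jy Jab; have Ji := L_ideal_free LJ; have [_ [_ [JD _]]] := Ji.
have [Jay _] := free_ideal_mul Ji af Jy; have [_ Jayb] := free_ideal_mul Ji bf Jay.
have -> : vmon v = a * y * b + - (a * y * b - vmon v) by rewrite opprB addrC subrK.
by apply: JD => //; apply: free_idealN.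
Qed.

Lemma homog_vertex v : @homog G K 0 (vmon v).
Proof.
split=> [|w]; first exact: fsupp_mon.
by rewrite monE; case: eqP => // -> _ /=; rewrite addr0.
Qed.

Lemma vertex_common_descendant J r v : L_ideal J -> hclosed J -> J r ->
  ~ (Rel (vmon v * r) /\ Rel (r * vmon v)) ->
  exists u t, [/\ J (vmon u), reach u t & reach v t].
Proof.
move=> LJ hJ Jr nR; have [Jf _] := LJ.
have LR := Rel_L_ideal G K; have Ri := @Rel_ideal G K.
have vf := @mon_fin G K [:: LV v].
have main n y : homog n y -> J y -> ~ Rel y ->
    (exists2 z, z \in @finite_support G K & y = vmon v * z \/ y = z * vmon v) ->
    exists u t, [/\ J (vmon u), reach u t & reach v t].
  move=> yn Jy nRy [z zf yz].
  (* No vertex is 0 in $L_K(G)$, so any edge outside [l] will do. *)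
  have ie w (l : seq (edge G)) : ~ Rel (vmon w) -> infinite_emitter w ->
      exists e, [/\ src e = w, e \notin l & ~ Rel (vmon (rng e))].
    move=> _ ie; apply: contrapT => ne; apply: ie; exists l => e ew.
    apply/In_mem; apply/negPn/negP => el; apply: ne.
    by exists e; split=> //; apply: vertex_neq0.
  have [a [b [u [af bf _ Rab]]]] := L_reduction LR ie yn nRy.
  have Ju : J (vmon u).
    by apply: (ideal_vertex LJ af bf Jy); apply: (L_ideal_Rel LJ).
  suff [t ut vt] : exists2 t, reach u t & reach v t by exists u, t.
  case: yz Rab => ->.
    rewrite mulrA -[a * vmon v * z * b]mulrA => Rab.
    apply: (L_common_descendant LR af _ Rab (@vertex_neq0 u)).
    by rewrite rpredM.
  rewrite mulrA => Rab.
  apply: (L_common_descendant LR _ bf Rab (@vertex_neq0 u)).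
  by rewrite rpredM.
have rf := Jf _ Jr; have vsupp : fsupp (vmon v) by apply: fsupp_mon.
have [Rvr|nRvr] := pselect (Rel (vmon v * r)).
  have nRrv : ~ Rel (r * vmon v) by move=> Rrv; apply: nR.
  have [n] := hcomp_notin Ri (fsuppM rf vsupp) nRrv.
  rewrite -[n]addr0 (hcomp_mull _ _ (homog_vertex v)) => nRn.
  apply: (main n _ _ _ nRn); last first.
  - by exists (hcomp n r); [apply/fsupp_fin/fsupp_hcomp | right].
  - by case: (free_ideal_mul (L_ideal_free LJ) vf (hJ n _ Jr)).
  rewrite -(hcomp_mull _ _ (homog_vertex v)) addr0; apply: homog_hcomp.
  exact: fsuppM.
have [n] := hcomp_notin Ri (fsuppM vsupp rf) nRvr.
rewrite -[n]add0r (hcomp_mulr _ _ (homog_vertex v)) => nRn.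
apply: (main n _ _ _ nRn); last first.
- by exists (hcomp n r); [apply/fsupp_fin/fsupp_hcomp | left].
- by case: (free_ideal_mul (L_ideal_free LJ) vf (hJ n _ Jr)).
rewrite -(hcomp_mulr _ _ (homog_vertex v)) add0r; apply: homog_hcomp.
exact: fsuppM.
Qed.

Lemma ann_vertex I h : L_ideal I -> I (vmon h) -> ~ ann I (vmon h).
Proof.
move=> LI Ih /(annE _ LI)[_ /(_ _ Ih)[Rhh _]]; apply: (@vertex_neq0 h).
have Ri := @Rel_ideal G K; have [_ [_ [RD _]]] := Ri.
have -> : vmon h = vmon h * vmon h + - (vmon h * vmon h - vmon h).
  by rewrite opprB addrC subrK.
apply: RD => //; apply: (free_idealN Ri) => J _ JS; rewrite mul_mon.
by apply: JS; apply: rel_vv.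
Qed.

Lemma condition1_escaping : condition1 G K -> escaping G.
Proof.
move=> c1 H hH sH v nHv; apply: contrapT => nd.
have reachH d : reach v d -> R_of H d.
  by move=> vd; apply: contrapT => nHd; apply: nd; exists d.
pose I := generated (@lpa_rel_mod G K H).
have Sh := @lpa_rel_mod_homog G K H.
have LI : L_ideal I by apply: generated_L_ideal => // g; left.
have hI : hclosed I by apply: generated_hclosed.
have IH h : H h -> I (vmon h) by move=> Hh J _; apply; right; exists h.
apply: (vertex_not_generated hH sH (K := K) nHv).
apply/(c1 I LI ((gradedP LI).2 hI)).
apply/(annE _ (ann_L_ideal LI)); split=> [|r annr]; first exact: fsupp_mon.
have LA := ann_L_ideal LI; have hA := ann_hclosed LI hI.
apply: contrapT => /(vertex_common_descendant LA hA annr).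
(* Descending from [u] through [t] puts [h] in both [I] and [ann I]. *)
move=> [u [t [annu ut /reachH[h [Hh th]]]]].
apply: (ann_vertex LI (IH _ Hh)).
exact: (hereditary_reach (L_hereditary (ann_L_ideal LI)) annu (reach_trans ut th)).
Qed.

Lemma condition2_condition1 : condition2 G -> condition1 G K.
Proof.
move=> c2 I LI /(gradedP LI) hI x; have esc := condition2_escaping c2.
have LA := ann_L_ideal LI; have LAA := ann_L_ideal LA.
have hAA := ann_hclosed LA (ann_hclosed LI hI).
have sub y : I y -> ann (ann I) y.
  move=> Iy; have [If _] := LI; apply/(annE _ LA); split=> [|r /(annE _ LI)[_ rI]].
    exact: If.
  by case: (rI _ Iy).
split=> [AAx|]; last exact: sub.
apply: contrapT => nIx; have [xf _] := AAx.
have [n nIn] := hcomp_notin (L_ideal_free LI) xf nIx.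
have hered := L_hereditary LI.
have [|a [b [u [af bf nIu Iab]]]] := L_reduction LI _ (homog_hcomp n xf) nIn.
  (* All edges of an infinite emitter return to it, so their ranges stay outside [I]. *)
  move=> w l nIw ie; apply: contrapT => ne; apply: (ie); exists l => e ew.
  apply/In_mem; apply/negPn/negP => el; apply: ne.
  exists e; split=> // Ire; apply: nIw; rewrite -ew.
  apply: (hereditary_reach hered Ire).
  by have [ca [cb _]] := c2; apply: infinite_emitter_returns => //; rewrite ew.
have AAu : ann (ann I) (vmon u).
  by apply: (ideal_vertex LAA af bf (hAA n _ AAx)); apply: sub.
have [d ud nd] := esc _ hered (L_saturated LI) _ nIu.
have AAd := hereditary_reach (L_hereditary LAA) AAu ud.
(* If [d] failed to annihilate [I], it would share a descendant with a vertex of [I], hence reach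
   [I]. *)
suff Ad : ann I (vmon d) by case: (ann_vertex LA Ad AAd).
apply/(annE _ LI); split=> [|y Iy]; first exact: fsupp_mon.
apply: contrapT => /(vertex_common_descendant LI hI Iy)[w [t [Iw wt dt]]].
by apply: nd; exists t; split=> //; apply: (hereditary_reach hered Iw wt).
Qed.

End Main.

Theorem theorem3p14 (G : graph) (K : fieldType) :
  condition1 G K <-> condition2 G.
Proof.
split; last exact: condition2_condition1.
by move=> /condition1_escaping; apply: escaping_condition2.
Qed.
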